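(* Let $X$ be a finite tree and let $f\colon X\to X$ be a continuous map. Then the following are equivalent: (a) $f$ is equicontinuous; (b) there is an $n\in\mathbb N$ such that the restriction of $f^n$ to $\bigcap_{m=1}^\infty f^m[X]$ is the identity map; (c) there exists an $n\in\mathbb N$ such that $\mathrm{Fix}(f^n)=\bigcap_{m=1}^\infty f^m[X]$; (d) $\mathrm{Per}(f)=\bigcap_{m=1}^\infty f^m[X]$; (e) there is no $f$-expanding arc in $X$; (f) for every $n\in\mathbb N$, the set $\mathrm{Fix}(f^n)$ is connected; (g) the set $\mathrm{Per}(f)$ is connected; (h) for every nonprincipal ultrafilter $u$ on $\mathbb N$, the function $f^u\colon X\to X$ is continuous; (i) for some nonprincipal ultrafilter $u$ on $\mathbb N$, the function $f^u\colon X\to X$ is continuous.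
   Context: $\mathbb N=\{1,2,3,\dots\}$. A continuum is a (nonempty) compact connected metric space. A dendrite is a locally connected continuum that contains no simple closed curve (no subspace homeomorphic to the unit circle). The order of a point $x$ in a dendrite $X$ is the number of connected components of $X\setminus\{x\}$; $x$ is a branching point if its order is at least $3$. A finite tree is a dendrite having only finitely many branching points, each of finite order. For a metric space $(X,d)$ and a continuous $f\colon X\to X$, $f^n$ denotes the $n$-fold iterate ($f^0=\mathrm{id}$). $f$ is equicontinuous if for every $x\in X$ and $\varepsilon>0$ there is $\delta>0$ such that for all $y\in X$ with $d(x,y)<\delta$ and all $n\in\mathbb N$, $d(f^n(x),f^n(y))\le\varepsilon$. $\mathrm{Fix}(f)=\{x: f(x)=x\}$ and $\mathrm{Per}(f)=\bigcup_{n=1}^\infty\mathrm{Fix}(f^n)$. An arc is a space homeomorphic to $[0,1]$. An arc $A\subseteq X$ is $f$-expanding if there is $n\in\mathbb N$ with $A\subsetneq f^n[A]$. For an ultrafilter $u$ on $\mathbb N$ and $X$ compact, $f^u\colon X\to X$ is defined by $f^u(x)=u\text{-}\lim_{n}f^n(x)$, i.e. $f^u(x)$ is the unique point $p\in X$ such that $\{n\in\mathbb N: d(p,f^n(x))<\varepsilon\}\in u$ for every $\varepsilon>0$. An ultrafilter is nonprincipal if it is not of the form $\{A\subseteq\mathbb N: n\in A\}$ for any $n\in\mathbb N$. *)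

(* Defs.v *)
From HB Require Import structures.
From mathcomp Require Import all_boot all_order all_algebra.
From mathcomp Require Import all_classical all_reals all_analysis.

Set Implicit Arguments.
Unset Strict Implicit.
Unset Printing Implicit Defensive.

Import Order.TTheory GRing.Theory Num.Theory.
Import numFieldNormedType.Exports.

Local Open Scope classical_set_scope.
Local Open Scope ring_scope.

(* The natural numbers start at 1: exponents of iterates are constrained by
   [0 < n], and ultrafilters live on the subtype [posnat]. *)
Definition posnat := {n : nat | (0 < n)%N}.

Definition homeomorphic (S T : topologicalType) : Prop :=
  exists (f : S -> T) (g : T -> S),
    [/\ continuous f, continuous g, cancel f g & cancel g f].

Definition unit_circle (R : realType) : set (R * R) :=
  [set p | p.1 ^+ 2 + p.2 ^+ 2 = 1].
Arguments unit_circle : clear implicits.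

Section Dendrites.
Context (R : realType) (X : metricType R).
Implicit Types (A : set X) (x : X).

(* [set_type A] carries the subspace topology of A. *)
Definition is_arc A : Prop :=
  homeomorphic (set_type (`[0, 1]%classic : set R)) (set_type A).

Definition is_simple_closed_curve A : Prop :=
  homeomorphic (set_type (unit_circle R)) (set_type A).

Definition is_continuum : Prop :=
  [/\ [set: X] !=set0, compact [set: X] & connected [set: X]].

Definition is_locally_connected : Prop :=
  forall x (U : set X), nbhs x U ->
    exists V : set X, [/\ open V, connected V, V x & V `<=` U].

Definition is_dendrite : Prop :=
  [/\ is_continuum, is_locally_connected
    & forall A, ~ is_simple_closed_curve A].

(* The order of x is the cardinality of this set of subsets of X. *)
Definition complement_components x : set (set X) :=
  [set connected_component (~` [set x]) y | y in ~` [set x]].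

Definition is_branching_point x : Prop :=
  (`I_3 #<= complement_components x)%card.

Definition is_finite_tree : Prop :=
  [/\ is_dendrite, finite_set is_branching_point
    & forall x, is_branching_point x -> finite_set (complement_components x)].

End Dendrites.

Arguments is_continuum {R} X.
Arguments is_locally_connected {R} X.
Arguments is_dendrite {R} X.
Arguments is_finite_tree {R} X.

Section Dynamics.
Context (R : realType) (X : metricType R).
Implicit Types (f : X -> X) (A : set X).

(* The library's [equicontinuous] requires a pointed codomain. *)
Definition is_equicontinuous f : Prop :=
  forall (x : X) (eps : R), 0 < eps -> exists2 delta : R, 0 < delta &
    forall y : X, mdist x y < delta ->
      forall n, (0 < n)%N -> mdist (iter n f x) (iter n f y) <= eps.

Definition Fix f : set X := [set x | f x = x].

Definition Per f : set X := \bigcup_(n in [set n | (0 < n)%N]) Fix (iter n f).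

Definition image_core f : set X :=
  \bigcap_(m in [set m | (0 < m)%N]) range (iter m f).

Definition is_expanding_arc f A : Prop :=
  is_arc A /\ exists n, (0 < n)%N /\ A `<` iter n f @` A.

Definition is_nonprincipal_ultrafilter (u : set_system posnat) : Prop :=
  UltraFilter u /\ forall n, u <> principal_filter n.

Definition is_ulim_iter (u : set_system posnat) f (x p : X) : Prop :=
  forall eps : R, 0 < eps -> u [set n | mdist p (iter (val n) f x) < eps].

(* f^u. When X is compact the limit exists and is unique (see [ultra_iterP] and
   [is_ulim_iter_unique]), so the default value x of [xget] plays no role. *)
Definition ultra_iter (u : set_system posnat) f : X -> X :=
  fun x => xget x (is_ulim_iter u f x).

Lemma is_ulim_iterE (u : set_system posnat) f x p : Filter u ->
  is_ulim_iter u f x p <-> iter (val n) f x @[n --> u] --> p.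
Proof.
move=> uF; split => [up|up eps eps0].
  by apply/metricType_numDomainType.cvgrPdist_lt => eps /up.
exact: (metricType_numDomainType.cvgr_dist_lt up).
Qed.

Lemma is_ulim_iter_unique (u : set_system posnat) f x p q : UltraFilter u ->
  is_ulim_iter u f x p -> is_ulim_iter u f x q -> p = q.
Proof.
move=> uF /is_ulim_iterE up /is_ulim_iterE uq.
exact: (cvg_unique (@metric_hausdorff _ X) up uq).
Qed.

Lemma ultra_iterP (u : set_system posnat) f x : compact [set: X] ->
  UltraFilter u -> is_ulim_iter u f x (ultra_iter u f x).
Proof.
move=> cX uF; apply: xgetPex.
have [p [_ clp]] := cX (iter (val n) f x @[n --> u]) _ filterT.
exists p => eps eps0.
have [//|uC] := in_ultra_setVsetC [set n | mdist p (iter (val n) f x) < eps] uF.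
have pB : nbhs p [set y | mdist p y < eps].
  by rewrite -ballEmdist; exact: nbhsx_ballx.
by have [y [/= yNB yB]] := clp (~` [set y | mdist p y < eps]) _ uC pB.
Qed.

End Dynamics.

(* Main.v *)
(* Moore's chain argument joins two points of an open connected set by a path;
   a maximal family of loops is cut out of it to make it monotone, and a monotone
   path is reparametrized to an arc by the function
     t |-> - \sum_n w_n dist (q r_n, q [0, t]),  (r_n) dense, w_n small.
   Two distinct arcs with the same endpoints would contain a circle, hence in a
   dendrite the arc from a to b is the intersection [seg a b] of all connected
   sets containing a and b.  Rooting the tree at a gives the partial order
   "seg a y x" (x lies before y), and finiteness of the tree makes X a union of
   finitely many chains.

   If x lies before its image f x, a maximal such point is fixed; so there is a
   fixed point beyond x.

   (e) -> (g): a point of seg p q, with p and q fixed by a power g of f, that is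
   moved by g makes one of the arcs seg p y, seg q y, seg p q expand.
   (g) -> (b): f preserves the order on the connected set Per f, so a period is
   at most the number of chains, and f^N is the identity on Per f.  If the core
   Y were larger, each maximal point of Y outside Per f would have a preimage
   below another such point; a cycle of these finitely many points gives a point
   lying before its image, hence a periodic point beyond it.
   (b) -> (a): X \ Y has finitely many gates into Y, all fixed by f^n; an orbit
   close to Y either enters Y and stops or stays at one gate, so that the
   iterates of f^n converge uniformly.
   (d) -> (e), (a) -> (e): A `<=` g @` A for a closed set A in the core forces
   equality, by following preimages inside A.
   (i) -> (g): between consecutive fixed points of g, one of the ends, p, repels
   on its side.  A maximality argument yields a fixed point q such that g moves
   the points of seg p q away from p.  Iterated preimages of any such point tend
   to p, so continuity of f^u prevents these points from reaching or converging
   to q; but then the points near q do converge to q. *)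
Require Import Defs.
From mathcomp Require Import all_boot all_order all_algebra.
From mathcomp Require Import all_classical all_reals all_analysis.
From mathcomp Require Import zify ring lra.

Set Implicit Arguments.
Unset Strict Implicit.
Unset Printing Implicit Defensive.

Import Order.TTheory GRing.Theory Num.Theory.
Import numFieldNormedType.Exports.

Local Open Scope classical_set_scope.
Local Open Scope ring_scope.

(* [lra] gives up when the context has an equation in an unordered type. *)
Ltac real_lra R := repeat match goal with
  | H : @eq ?T _ _ |- _ => assert_fails (unify T (Real.sort R)); clear H
  | H : ~ @eq ?T _ _ |- _ => assert_fails (unify T (Real.sort R)); clear H
  end; lra.

(** * Retraction of the line onto the unit interval *)

Section Clip.
Context (R : realType).
Implicit Types (s t : R).

(** Paths are total functions on [R]; composing with this retraction brings every parameter back to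
    [0, 1]. *)
Definition clip t := Num.max 0 (Num.min 1 t).

Lemma clipE t : [\/ t <= 0 /\ clip t = 0, 0 <= t <= 1 /\ clip t = t
  | 1 <= t /\ clip t = 1].
Proof.
rewrite /clip; have [t0|t0] := leP t 0.
  by apply: Or31; rewrite min_r ?max_l//; lra.
have [t1|t1] := leP t 1; first by apply: Or32; rewrite (max_r (ltW t0)) (ltW t0).
by apply: Or33; rewrite (max_r ler01) (ltW t1).
Qed.

Lemma clip_itv t : 0 <= clip t <= 1.
Proof. by case: (clipE t) => -[tt ->]; rewrite ?lexx ?ler01. Qed.

Lemma clip_id t : 0 <= t <= 1 -> clip t = t.
Proof. by move=> t01; case: (clipE t) => -[tt ->] //; lra. Qed.

Lemma clip_lipschitz s t : `|clip s - clip t| <= `|s - t|.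
Proof.
have := ler_norm (s - t); have := ler_norm (t - s); rewrite (distrC t s).
have := normr_ge0 (s - t).
case: (clipE s) => -[ss ->]; case: (clipE t) => -[tt ->] => *;
  apply/ler_normlP; split; lra.
Qed.

Lemma le_clip s t : s <= t -> clip s <= clip t.
Proof.
by move=> st; case: (clipE s) => -[ss ->]; case: (clipE t) => -[tt ->]; lra.
Qed.

Lemma clip_continuous : continuous clip.
Proof.
move=> t; apply/cvgrPdist_lt => e e0; apply/nbhs_ballP; exists e => // s.
exact: le_lt_trans (clip_lipschitz _ _).
Qed.

End Clip.

(** * Arcs in locally connected continua *)

Section MetricBasics.
Context (R : realType) (X : metricType R).
Implicit Types (x y : X) (U C : set X).

Lemma nbhs_mdistE x U :
  nbhs x U <-> exists2 e : R, 0 < e & forall y, mdist x y < e -> U y.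
Proof.
rewrite -metricType_numDomainType.filter_from_mdist_nbhs; split.
  by move=> [e e0 eU]; exists e.
by move=> [e e0 eU]; exists e.
Qed.

Lemma open_mdist U :
  open U <-> forall x, U x -> exists2 e : R, 0 < e & forall y, mdist x y < e -> U y.
Proof.
rewrite openE; split=> [h x /h /nbhs_mdistE//|h x /h].
by move/nbhs_mdistE.
Qed.

Lemma continuous_mdist (f : R -> X) :
  continuous f <-> forall t (e : R), 0 < e ->
    exists2 d : R, 0 < d & forall s, `|t - s| < d -> mdist (f t) (f s) < e.
Proof.
split=> [cf t e e0|h t].
  have /metricType_numDomainType.cvgrPdist_lt/(_ e e0) := cf t.
  by move=> /nbhs_ballP [d d0 dP]; exists d => // s /dP.
apply/metricType_numDomainType.cvgrPdist_lt => e /(h t) [d d0 dP].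
by apply/nbhs_ballP; exists d => // s /dP.
Qed.

Lemma eq_mdist_le x y : (forall e : R, 0 < e -> mdist x y <= e) -> x = y.
Proof.
move=> h; apply: mdist_positivity; apply/eqP; rewrite eq_le mdist_ge0 andbT.
by apply/ler_addgt0Pl => e e0; rewrite addr0 h.
Qed.

(** The points of [C] reachable from [x] by such chains form a set that is open and closed in [C].
    Staying at [y] from index [M] on allows finitely many chains to be given a common length. *)
Lemma connected_chain C x y (d : R) : 0 < d -> connected C -> C x -> C y ->
  exists (M : nat) (c : nat -> X), [/\ c 0%N = x,
    forall r, (M <= r)%N -> c r = y, forall r, mdist (c r) (c r.+1) < d
    & forall r, C (c r)].
Proof.
move=> d0 Cc Cx Cy.
pose reach z := exists (M : nat) (c : nat -> X), [/\ c 0%N = x,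
    forall r, (M <= r)%N -> c r = z, forall r, mdist (c r) (c r.+1) < d
    & forall r, C (c r)].
have step z z' : reach z -> C z' -> mdist z z' < d -> reach z'.
  move=> [M [c [c0 cM cd cC]]] Cz' zz'.
  exists M.+1, (fun r => if (r <= M)%N then c r else z'); split => //.
  - by move=> r rM; rewrite leqNgt rM.
  - move=> r; case: ltngtP => rM; rewrite ?mdistxx// ?cd//.
    by rewrite rM cM.
  - by move=> r; case: ifP.
have key : C `&` reach = C.
  apply: Cc.
  - exists x; split => //; exists 0%N, (fun=> x).
    by split => // r; rewrite mdistxx.
  - exists [set z | exists2 z', reach z' & mdist z' z < d].
      apply/open_mdist => z [z' rz' z'z].
      exists (d - mdist z' z); first by rewrite subr_gt0.
      move=> w zw; exists z' => //.
      by rewrite (le_lt_trans (metric_triangle z' z w))// -ltrBrDl.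
    apply/seteqP; split => z [Cz rz]; split => //.
      by exists z => //; rewrite mdistxx.
    by case: rz => z' /step /(_ Cz); apply.
  - exists (~` [set z | exists z', [/\ C z', ~ reach z' & mdist z' z < d]]).
      apply: open_closedC; apply/open_mdist => z [z' [Cz' rz' z'z]].
      exists (d - mdist z' z); first by rewrite subr_gt0.
      move=> w zw; exists z'; split => //.
      by rewrite (le_lt_trans (metric_triangle z' z w))// -ltrBrDl.
    apply/seteqP; split => z [Cz rz]; split => //.
      move=> [z' [Cz' nrz' z'z]]; apply: nrz'; apply: step rz Cz' _.
      by rewrite metric_sym.
    apply: contrapT => nr; apply: rz; exists z; split => //.
    by rewrite mdistxx.
have : (C `&` reach) y by rewrite key.
by move=> [].
Qed.

(** A Lebesgue number argument: compactness turns the radii provided by local connectedness at each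
    point into a single [d]. *)
Lemma uniformly_locally_connected (e : R) :
  compact [set: X] -> is_locally_connected X -> 0 < e ->
  exists2 d : R, 0 < d & forall x y, mdist x y < d ->
    exists C, [/\ connected C, C x, C y & forall z, C z -> mdist x z < e].
Proof.
move=> cX lX e0.
have /compact_near_coveringP cov := cX.
pose Q (d : R) x := forall y, mdist x y < d ->
    exists C, [/\ connected C, C x, C y & forall z, C z -> mdist x z < e].
have h : \forall d \near (0:R)^'+, [set: X] `<=` Q d.
  apply: cov => x _.
  have e20 : 0 < e / 2 by rewrite divr_gt0.
  have xU : nbhs x [set y | mdist x y < e / 2].
    by apply/nbhs_mdistE; exists (e / 2).
  have [V [oV cV Vx VU]] := lX x _ xU.
  have [r r0 rV] := (open_mdist V).1 oV x Vx.
  have r20 : 0 < r / 2 by rewrite divr_gt0.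
  exists ([set y | mdist x y < r / 2], [set d | 0 < d < r / 2]).
    split; first by apply/nbhs_mdistE; exists (r / 2).
    apply/nbhs_ballP; exists (r / 2) => // d /=; rewrite /ball/= sub0r normrN.
    by move=> dr d0; rewrite /= d0 (le_lt_trans _ dr)// ler_norm.
  move=> [x' d] [/= xx' /andP[d0 dr] y x'y].
  have Vx' : V x' by apply: rV; lra.
  have Vy : V y.
    by apply: rV; have := metric_triangle x x' y; lra.
  exists V; split => // z /VU /= xz.
  have := metric_triangle x' x z; have := VU _ Vx' => /=.
  by rewrite (metric_sym x' x); lra.
have : \forall d \near (0:R)^'+, 0 < d /\ [set: X] `<=` Q d.
  by near=> d; split; near: d; [exact: nbhs_right_gt|exact: h].
by move/filter_ex => [d [d0 hd]]; exists d => // x y xy; exact: hd.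
Unshelve. all: by end_near. Qed.

End MetricBasics.

(** * Moore's chain construction of paths *)

Section Paths.
Context (R : realType) (X : metricType R).
Implicit Types (x y : X) (U C : set X) (P : R -> X).

(** Such a [P] may be discontinuous, but its jumps are smaller than [d]. Continuous paths arise as
    limits of linked ones with [d] tending to 0. *)
Definition linked (d : R) P := exists2 h : R, 0 < h &
  forall s t, `|s - t| <= h -> mdist (P s) (P t) < d.

(** The interval [0, 1] is cut into [L] pieces so short that [P] moves by less than [d] on each. The
    values at the ends of a piece are joined by a [d']-chain in a small connected set, and these
    chains are concatenated into a step function. *)
Lemma refine_linked (d e d' : R) P : 0 < d' ->
  (forall x y, mdist x y < d ->
    exists C, [/\ connected C, C x, C y & forall z, C z -> mdist x z < e]) ->
  linked d P ->
  exists P' : R -> X, [/\ linked d' P', P' 0 = P 0, P' 1 = P 1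
    & forall t, 0 <= t <= 1 -> mdist (P t) (P' t) < d + e].
Proof.
move=> d'0 de [h h0 Ph].
pose L := (Num.truncn h^-1).+1.
have L0 : 0 < L%:R :> R by rewrite ltr0n.
have Lh : L%:R^-1 <= h.
  rewrite -[h]invrK lef_pV2 ?posrE ?invr_gt0//.
  by apply/ltW; rewrite /L -truncn_le_nat.
pose p (i : nat) := P (i%:R / L%:R).
have /choice[Mc chainP] : forall i, exists Mc : nat * (nat -> X),
   [/\ Mc.2 0%N = p i, forall r, (Mc.1 <= r)%N -> Mc.2 r = p i.+1,
       forall r, mdist (Mc.2 r) (Mc.2 r.+1) < d'
     & forall r, mdist (p i) (Mc.2 r) < e].
  move=> i.
  have /de [C [Cc Cx Cy Ce]] : mdist (p i) (p i.+1) < d.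
    apply: Ph; rewrite -mulrBl -(natr1 i) opprD addNKr normrM normrN1 mul1r.
    by rewrite gtr0_norm ?invr_gt0.
  have [M [c [c0 cM cd cC]]] := connected_chain d'0 Cc Cx Cy.
  by exists (M, c); split => // r; apply: Ce.
pose M := (\max_(i < L) (Mc i).1).+1.
have MP i : (i < L)%N -> ((Mc i).1 <= M)%N.
  by move=> iL; apply/leqW/(@leq_bigmax _ (fun i : 'I_L => (Mc i).1) (Ordinal iL)).
have M0 : 0 < M%:R :> R by rewrite ltr0n.
pose N := (L * M)%N.
have N0 : 0 < N%:R :> R by rewrite ltr0n muln_gt0.
(* Point [j] of the concatenation is point [j %% M] of chain number [j %/ M]. *)
pose c j := (Mc (j %/ M)%N).2 (j %% M)%N.
have cstep j : (j < N)%N -> mdist (c j) (c j.+1) < d'.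
  move=> jN; rewrite /c.
  have iL : (j %/ M < L)%N by rewrite ltn_divLR.
  have [rM|rM] := ltnP (j %% M).+1 M.
    have -> : (j.+1 %/ M = j %/ M)%N.
      by rewrite {1}(divn_eq j M) -addnS divnMDl// (divn_small rM) addn0.
    have -> : (j.+1 %% M = (j %% M).+1)%N.
      by rewrite {1}(divn_eq j M) -addnS modnMDl modn_small.
    by have [_ _ + _] := chainP (j %/ M)%N; apply.
  (* At the end of a piece, the next point of the current chain is already its final one, where the
     following chain starts. *)
  have rE : (j %% M).+1 = M by apply/eqP; rewrite eqn_leq rM andbT ltn_mod.
  have jE : j.+1 = ((j %/ M).+1 * M + 0)%N.
    by rewrite {1}(divn_eq j M) -addnS rE mulSn addn0 addnC.
  rewrite jE divnMDl// modnMDl div0n mod0n addn0.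
  have [-> _ _ _] := chainP (j %/ M).+1.
  have [_ cM cd _] := chainP (j %/ M)%N.
  by rewrite -(cM M (MP _ iL)); have := cd (j %% M)%N; rewrite rE.
(* [minn N] keeps the path constant after 1, and [truncn] sends negative numbers to 0; both matter
   because [linked] speaks of all real parameters. *)
pose fl (t : R) := minn N (Num.truncn (t * N%:R)).
have flle (s t : R) : s <= t -> (fl s <= fl t)%N.
  move=> st; rewrite /fl leq_min geq_minl/= (leq_trans (geq_minr _ _))//.
  by apply: le_truncn; rewrite ler_wpM2r// ltW.
have flS (s t : R) : s <= t -> t <= s + N%:R^-1 -> (fl t <= (fl s).+1)%N.
  move=> st tsN; rewrite /fl.
  have : (Num.truncn (t * N%:R) <= (Num.truncn (s * N%:R)).+1)%N.
    rewrite truncn_le_nat -natr1; have := truncnS_gt (s * N%:R).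
    have := ler_wpM2r (ltW N0) tsN.
    by rewrite mulrDl mulVf ?gt_eqF//; lra.
  move: (Num.truncn _) (Num.truncn _) => a b ab; clear -ab.
  by rewrite /minn; case: ltnP => ?; case: ltnP => ?; lia.
exists (c \o fl); split.
- exists N%:R^-1; first by rewrite invr_gt0.
  suff sym (s t : R) : s <= t -> `|s - t| <= N%:R^-1 -> mdist ((c \o fl) s) ((c \o fl) t) < d'.
    move=> s t; have [/sym//|/ltW ts] := leP s t.
    by rewrite distrC metric_sym; exact: sym.
  move=> st; rewrite ler0_norm ?subr_le0// opprB lerBlDl => tsN /=.
  have := flle _ _ st; have := flS _ _ st tsN.
  have flN : (fl t <= N)%N by rewrite /fl geq_minl.
  rewrite leq_eqVlt => /predU1P[tE _|].
    by rewrite tE; apply: cstep; rewrite -tE.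
  rewrite ltnS => ts st'; have -> : fl s = fl t by apply/eqP; rewrite eqn_leq st'.
  by rewrite mdistxx.
- rewrite /= /fl mul0r truncn0 minn0 /c div0n mod0n.
  by have [-> _ _ _] := chainP 0%N; rewrite /p mul0r.
- rewrite /= /fl mul1r natrK minnn /c /N mulnK// modnMl.
  by have [-> _ _ _] := chainP L; rewrite /p divff// gt_eqF.
- move=> t /andP[t0 t1] /=.
  have tN0 : 0 <= t * N%:R by rewrite mulr_ge0// ltW.
  have -> : fl t = Num.truncn (t * N%:R).
    have tN : t * N%:R <= N%:R by rewrite ler_piMl// ltW.
    by apply/minn_idPr; have := le_truncn tN; rewrite natrK.
  have /andP[jl ju] := truncn_itv tN0.
  set j := Num.truncn _ in jl ju *.
  apply: (le_lt_trans (metric_triangle _ (p (j %/ M)%N) _)).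
  apply: ltrD; last by have [_ _ _] := chainP (j %/ M)%N; apply.
  apply: Ph; apply: le_trans Lh.
  have il : (j %/ M)%:R <= t * L%:R.
    rewrite -(ler_pM2r M0) -mulrA -!natrM; apply: le_trans jl.
    by rewrite ler_nat leq_trunc_div.
  have iu : t * L%:R < (j %/ M).+1%:R.
    rewrite -(ltr_pM2r M0) -mulrA -!natrM; apply: (lt_le_trans ju).
    by rewrite ler_nat ltn_ceil.
  have -> : t - (j %/ M)%:R / L%:R = (t * L%:R - (j %/ M)%:R) / L%:R.
    by field; rewrite gt_eqF.
  rewrite normrM [X in _ * X]gtr0_norm ?invr_gt0// ler_piMl ?invr_ge0 ?ltW//.
  move: iu; rewrite -natr1 => iu.
  by rewrite ger0_norm; lra.
Qed.

End Paths.

Section LocalPaths.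
Context (R : realType) (X : metricType R).
Implicit Types (x y : X) (U C : set X) (P : R -> X).

Lemma exists_halfpow_lt (e : R) : 0 < e -> exists n : nat, 2^-1 ^+ n < e.
Proof.
move=> e0; exists (Num.truncn e^-1).
rewrite exprVn -[ltRHS]invrK ltf_pV2 ?posrE ?invr_gt0 ?exprn_gt0//.
apply: (lt_le_trans (truncnS_gt _)).
by rewrite -natrX ler_nat ltn_expl.
Qed.

(** Starting from the path that jumps from [x] to [y], refinement is repeated with jumps tending to
    0. The displacements are summable, so the limit is uniform and continuous. *)
Lemma local_path (e : R) :
  compact [set: X] -> is_locally_connected X -> 0 < e ->
  exists2 d : R, 0 < d & forall x y, mdist x y < d ->
    exists g : R -> X, [/\ continuous g, g 0 = x, g 1 = y
      & forall t, mdist x (g t) < e].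
Proof.
move=> cX lX e0.
(* Stage [n] moves points by less than [2 * ep n], hence by at most [4 * ep 0] in total; with the
   initial jump, at most [ep 0], this remains below [e]. *)
pose ep n : R := e / 32 * 2^-1 ^+ n.
have ep0 n : 0 < ep n by rewrite mulr_gt0 ?exprn_gt0 ?divr_gt0.
have epS n : ep n.+1 = ep n / 2 by rewrite /ep exprS; field.
have eplt (h : R) : 0 < h -> exists n, ep n < h.
  move=> h0; have [|n nh] := @exists_halfpow_lt (h / (e / 32)).
    by rewrite !divr_gt0.
  exists n; rewrite /ep mulrC -ltr_pdivlMr ?divr_gt0//.
have /choice[D DP] : forall n, exists d, [/\ 0 < d, d <= ep n &
    forall x y, mdist x y < d ->
    exists C, [/\ connected C, C x, C y & forall z, C z -> mdist x z < ep n]].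
  move=> n; have [d d0 dP] := uniformly_locally_connected cX lX (ep0 n).
  exists (Num.min d (ep n)); split; first by rewrite lt_min d0 ep0.
    by rewrite ge_min lexx orbT.
  by move=> x y; rewrite lt_min => /andP[/dP].
exists (D 0%N); first by have [] := DP 0%N.
move=> x y xy.
have /choice[nxt nxtP] : forall nP : nat * (R -> X), exists P' : R -> X,
    linked (D nP.1) nP.2 -> [/\ linked (D nP.1.+1) P', P' 0 = nP.2 0,
      P' 1 = nP.2 1 & forall t, 0 <= t <= 1 -> mdist (nP.2 t) (P' t) < 2 * ep nP.1].
  move=> [n P] /=; have [lP|nlP] := pselect (linked (D n) P); last by exists P.
  have [_ Dn Dc] := DP n; have [DS0 _ _] := DP n.+1.
  have [P' [lP' P'0 P'1 PP']] := refine_linked DS0 Dc lP.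
  exists P' => _; split => // t t01; have := PP' t t01.
  by move: (mdist _ _) Dn => ? ?; lra.
pose S := fix S n := if n is m.+1 then nxt (m, S m) else
  (fun t : R => if t <= 0 then x else y).
have D00 : 0 < D 0%N by have [] := DP 0%N.
have lS n : linked (D n) (S n).
  elim: n => [|n IHn]; last by have [] := nxtP (n, S n) IHn.
  by exists 1 => // s t _ /=; do 2 case: ifP => _; rewrite ?mdistxx// metric_sym.
have S0 n : S n 0 = x.
  elim: n => [/=|n IHn]; first by rewrite lexx.
  by have [_ + _ _] := nxtP (n, S n) (lS n) => /= ->.
have S1 n : S n 1 = y.
  elim: n => [/=|n IHn]; first by rewrite leNgt ltr01.
  by have [_ _ + _] := nxtP (n, S n) (lS n) => /= ->.
(* The bound telescopes, since [4 * ep n - 4 * ep n.+1 = 2 * ep n]. *)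
have tailS n k t : 0 <= t <= 1 -> mdist (S n t) (S (n + k)%N t) <= 4 * ep n - 4 * ep (n + k)%N.
  move=> t01; elim: k => [|k IHk]; first by rewrite addn0 mdistxx subrr.
  have [_ _ _ /(_ t t01)/=] := nxtP (n + k, S (n + k))%N (lS _).
  have := metric_triangle (S n t) (S (n + k)%N t) (S (n + k.+1)%N t).
  have := epS (n + k)%N; rewrite addnS /=.
  by move: IHk; lra.
(* A cluster point, given by compactness, serves as the pointwise limit; the tail bound passes to
   it. *)
have /choice[g gP] : forall t, exists p, forall n, mdist (S n (clip t)) p <= 4 * ep n.
  move=> t.
  have [|p [_ clp]] := cX (S n (clip t) @[n --> \oo]); first exact: filterT.
  exists p => n; apply/ler_addgt0Pl => h h0.
  have [||z [/= [m nm <-] pz]] := clp [set S m (clip t) | m in [set m | (n <= m)%N]]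
     [set z | mdist p z < h].
  - by exists n => // m /= nm; exists m.
  - by apply/nbhs_mdistE; exists h.
  have := tailS n (m - n)%N (clip t) (clip_itv t).
  rewrite subnKC// => h1; have := metric_triangle (S n (clip t)) (S m (clip t)) p.
  rewrite (metric_sym (S m (clip t)) p); have := ep0 m; move: h1 pz => /=; lra.
exists g; split.
- apply/continuous_mdist => t h h0.
  have [|n nh] := eplt (h / 9); first by rewrite divr_gt0.
  have [k k0 kP] := lS n.
  exists k => // s ts.
  have := kP (clip t) (clip s) (le_trans (clip_lipschitz _ _) (ltW ts)).
  have [_ Dn _] := DP n.
  have := gP t n; have := gP s n.
  have := metric_triangle (g t) (S n (clip t)) (g s).
  have := metric_triangle (S n (clip t)) (S n (clip s)) (g s).
  rewrite (metric_sym (g t) (S n (clip t))); lra.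
- apply/esym/eq_mdist_le => h h0.
  have [|n nh] := eplt (h / 4); first by rewrite divr_gt0.
  by have := gP 0 n; rewrite clip_id ?lexx ?ler01// S0; lra.
- apply/esym/eq_mdist_le => h h0.
  have [|n nh] := eplt (h / 4); first by rewrite divr_gt0.
  by have := gP 1 n; rewrite clip_id ?lexx ?ler01// S1; lra.
- move=> t; have := gP t 0%N; have [_ D0 _] := DP 0%N.
  have : mdist x (S 0%N (clip t)) < D 0%N by rewrite /=; case: ifP; rewrite ?mdistxx.
  have := metric_triangle x (S 0%N (clip t)) (g t).
  have : ep 0%N = e / 32 by rewrite /ep expr0 mulr1.
  lra.
Qed.

End LocalPaths.

Section PathConnected.
Context (R : realType) (X : metricType R).
Implicit Types (x y : X) (U C : set X) (P : R -> X).

Lemma continuous_if (T S : topologicalType) (k : T -> R) (f g : T -> S) :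
  continuous k -> continuous f -> continuous g ->
  (forall t : T, k t = 0 -> f t = g t) ->
  continuous (fun t : T => if k t <= 0 then f t else g t).
Proof.
move=> ck cf cg fg t V /=; case: (ltgtP (k t) 0) => kt nV;
  suff: nbhs t [set s | V (if k s <= 0 then f s else g s)] by [].
- have kV : nbhs t [set s | k s < 0] := ck t [set r | r < 0] (lt_nbhsl kt).
  have fV : nbhs t [set s | V (f s)] := cf t _ nV.
  by apply: filterS (filterI fV kV) => s [/= fs ks]; rewrite (ltW ks).
- have kV : nbhs t [set s | 0 < k s] := ck t [set r | 0 < r] (lt_nbhsr kt).
  have gV : nbhs t [set s | V (g s)] := cg t _ nV.
  by apply: filterS (filterI gV kV) => s [/= gs ks]; rewrite leNgt ks.
- have mV := nV; rewrite (fg _ kt) in mV.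
  have fV : nbhs t [set s | V (f s)] := cf t _ nV.
  have gV : nbhs t [set s | V (g s)] := cg t _ mV.
  by apply: filterS (filterI fV gV) => s [/= fs gs]; case: ifP.
Qed.

Lemma affine_continuous (a b : R) : continuous (fun t : R => a * t + b).
Proof.
move=> t; apply: cvgD; last exact: cvg_cst.
by apply: cvgM; [exact: cvg_cst|exact: cvg_id].
Qed.

Lemma continuous_comp_affine (T : topologicalType) (g : R -> T) (a b : R) :
  continuous g -> continuous (fun t : R => g (a * t + b)).
Proof.
by move=> cg t; apply: (@continuous_comp _ _ _ (fun t => a * t + b) g); [exact: affine_continuous|exact: cg].
Qed.

Definition path_in U x y := exists g : R -> X, [/\ continuous g, g 0 = x, g 1 = y
  & forall t, 0 <= t <= 1 -> U (g t)].

Lemma path_in_trans U x y z : path_in U x y -> path_in U y z -> path_in U x z.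
Proof.
move=> [g [cg g0 g1 gU]] [h [ch h0 h1 hU]].
exists (fun t => if 1 * t + - 2^-1 <= 0 then g (2 * t + 0) else h (2 * t - 1)); split.
- apply: continuous_if; first exact: affine_continuous.
  + exact: continuous_comp_affine.
  + exact: continuous_comp_affine.
  + move=> t t2; rewrite [2 * t + 0](_ : _ = 1); last lra.
    by rewrite [2 * t - 1](_ : _ = 0) ?g1 ?h0//; lra.
- by rewrite mulr0 add0r oppr_le0 invr_ge0 ler0n mulr0 addr0.
- have -> : (1 * 1 + - 2^-1 <= 0 :> R) = false by apply/negbTE; rewrite -ltNge; lra.
  by rewrite mulr1 [2 - 1](_ : _ = 1) ?h1//; lra.
- move=> t t01; case: ifP => [t2|/negbT]; first by apply: gU; lra.
  by rewrite -ltNge => t2; apply: hU; lra.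
Qed.

(** By [local_path], the set of points of [U] that a path in [U] joins to [x] is both open and
    closed in [U]. *)
Lemma open_connected_path U x y : compact [set: X] -> is_locally_connected X ->
  open U -> connected U -> U x -> U y -> path_in U x y.
Proof.
move=> cX lX oU cU Ux Uy.
have loc a : U a -> exists2 d : R, 0 < d & forall b, mdist a b < d -> path_in U a b /\ path_in U b a.
  move=> Ua; have [e e0 eU] := (open_mdist U).1 oU a Ua.
  have e20 : 0 < e / 2 by rewrite divr_gt0.
  have [d d0 dP] := local_path cX lX e20.
  exists (Num.min d (e / 2)); first by rewrite lt_min d0.
  move=> b; rewrite lt_min => /andP[abd abe]; split.
    have [g [cg g0 g1 gP]] := dP a b abd; exists g; split => // t _.
    by apply: eU; have := gP t; lra.
  have [g [cg g0 g1 gP]] := dP b a (eq_rect _ (fun r => r < d) abd _ (metric_sym _ _)).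
  exists g; split => // t _; apply: eU; have := gP t.
  by have := metric_triangle a b (g t); lra.
suff UE : U `&` path_in U x = U by apply: (proj2 (_ : (U `&` path_in U x) y)); rewrite UE.
apply: cU.
- exists x; split => //; exists (fun=> x); split => //; exact: cst_continuous.
- exists (U `&` path_in U x); last by rewrite setIA setIid.
  apply/open_mdist => a [Ua pa].
  have [d d0 dP] := loc a Ua; have [e e0 eU] := (open_mdist U).1 oU a Ua.
  exists (Num.min d e); first by rewrite lt_min d0.
  move=> b; rewrite lt_min => /andP[/dP[ab _] /eU Ub]; split => //.
  exact: path_in_trans pa ab.
- exists (~` (U `&` ~` path_in U x)).
    apply: open_closedC; apply/open_mdist => a [Ua pa].
    have [d d0 dP] := loc a Ua; have [e e0 eU] := (open_mdist U).1 oU a Ua.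
    exists (Num.min d e); first by rewrite lt_min d0.
    move=> b; rewrite lt_min => /andP[/dP[_ ba] /eU Ub]; split => // pb.
    by apply: pa; exact: path_in_trans pb ba.
  apply/seteqP; split => a [Ua pa]; split => //; first by move=> [].
  by apply: contrapT => npa; apply: pa.
Qed.

End PathConnected.

(** * Closed sets of reals and chains of open sets *)

Section RealClosed.
Context (R : realType).
Implicit Types (O K : set R).

Lemma open_real O : open O <-> forall t, O t ->
  exists2 d : R, 0 < d & forall s, `|t - s| < d -> O s.
Proof.
rewrite openE; split=> [h t /h /nbhs_ballP [d d0 dP]|h t /h [d d0 dP]].
  by exists d.
by apply/nbhs_ballP; exists d.
Qed.

Lemma closed_last K (a b : R) : closed K -> K a -> a <= b ->
  exists l, [/\ K l, a <= l <= b & forall u, l < u -> u <= b -> ~ K u].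
Proof.
move=> cK Ka ab; pose A := [set u | K u /\ u <= b].
have hA : has_sup A by split; [exists a|exists b => u []].
have lb : sup A <= b by apply: ge_sup; [exists a|move=> u []].
have al : a <= sup A by apply: ub_le_sup; [exact: hA.2|].
exists (sup A); split; last first.
- move=> u lu ub Ku; have : u <= sup A by apply: ub_le_sup; [exact: hA.2|].
  by rewrite leNgt lu.
- by rewrite al.
- apply: contrapT => nKl.
  have [d d0 dP] := (open_real (~` K)).1 (closed_openC cK) _ nKl.
  have [u [Ku ub] lu] := sup_adherent d0 hA.
  apply: (dP u) => //; rewrite ger0_norm ?subr_ge0; first lra.
  by apply: ub_le_sup; [exact: hA.2|].
Qed.

Lemma closed_first K (a b : R) : closed K -> K b -> a <= b ->
  exists l, [/\ K l, a <= l <= b & forall u, a <= u -> u < l -> ~ K u].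
Proof.
move=> cK Kb ab.
have [|||l [Kl lab lP]] := @closed_last [set u | K (- u)] (- b) (- a).
- by apply: (@closed_comp _ _ (fun u : R => - u)) => // u _; exact: opp_continuous.
- by rewrite /= opprK.
- by rewrite lerN2.
exists (- l); split => //; first by rewrite lerNr lerNl andbC.
by move=> u au ul; have := lP (- u); rewrite /= opprK; apply; lra.
Qed.

(** A finite subcover taken from a chain has a largest member. The filter [G] of tails of the chain
    expresses this as a near covering. *)
Lemma compact_chain_cover (T : topologicalType) (K : set T) (F : set (set T)) :
  compact K -> F !=set0 -> total_on F subset -> (forall A, F A -> open A) ->
  K `<=` \bigcup_(A in F) A -> exists2 A, F A & K `<=` A.
Proof.
move=> /compact_near_coveringP cK [A0 FA0] tF oF KF.
pose G : set_system (set T) := [set Q | exists2 A, F A & forall B, F B -> A `<=` B -> Q B].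
have FG : Filter G.
  split; first by exists A0.
    move=> P Q [A FA AP] [B FB BQ].
    have [AB|BA] := tF A B FA FB; [exists B|exists A] => // C FC sC; split.
    + by apply: AP => //; exact: subset_trans sC.
    + exact: BQ.
    + exact: AP.
    + by apply: BQ => //; exact: subset_trans sC.
  by move=> P Q PQ [A FA AP]; exists A => // B FB /(AP B FB)/PQ.
have [] := cK _ G (fun A t => A t) FG.
  move=> t /KF [A FA At]; exists (A, [set B | F B /\ A `<=` B]).
    split => /=; first by apply: open_nbhs_nbhs; split => //; exact: oF.
    by exists A.
  by move=> [s B] [/= As [_ AB]]; exact: AB.
by move=> A FA AP; exists A => //; exact: AP.
Qed.

End RealClosed.

(** * Cutting the loops out of a path *)

Section MonotonePath.
Context (R : realType) (X : metricType R).

(** [O] is the set of parameters to be cut out: each of its maximal intervals is a loop of [p]. *)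
Definition loop_gaps (p : R -> X) (O : set R) :=
  [/\ open O, O `<=` [set t | 0 < t < 1] & forall s t, s < t -> ~ O s -> ~ O t ->
    (forall u, s < u < t -> O u) -> p s = p t].

(** A gap of the union need not be a gap of a member, but its compact part [s + h, t - h] lies in
    one member, by [compact_chain_cover]. The gap of that member has ends within [h] of [s] and [t],
    and [p] agrees at these ends; continuity gives the claim as [h] tends to 0. *)
Lemma loop_gaps_chain (p : R -> X) (F : set (set R)) : continuous p ->
  F `<=` loop_gaps p -> total_on F subset ->
  loop_gaps p (\bigcup_(A in F) A).
Proof.
move=> cp FP tF; split.
- by apply: bigcup_open => A /FP[].
- by move=> t [A /FP[_ AP _] /AP].
move=> s t st Os Ot stO; apply: eq_mdist_le => e e0.
have e20 : 0 < e / 2 by rewrite divr_gt0.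
have [d1 d10 d1P] := (continuous_mdist p).1 cp s _ e20.
have [d2 d20 d2P] := (continuous_mdist p).1 cp t _ e20.
have [h [h0 h1 h2 h3]] : exists h, [/\ 0 < h, h < d1, h < d2 & s + h < t - h].
  have m0 : 0 < Num.min (Num.min d1 d2) (t - s) by rewrite !lt_min d10 d20 subr_gt0.
  exists (Num.min (Num.min d1 d2) (t - s) / 3); move: m0.
  have : Num.min (Num.min d1 d2) (t - s) <= d1 by rewrite !ge_min lexx.
  have : Num.min (Num.min d1 d2) (t - s) <= d2 by rewrite !ge_min lexx orbT.
  have : Num.min (Num.min d1 d2) (t - s) <= t - s by rewrite !ge_min lexx orbT.
  by move: (Num.min _ _) => m *; split; lra.
have [A FA hA] : exists2 A, F A & `[s + h, t - h]%classic `<=` A.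
  apply: compact_chain_cover => //; first exact: segment_compact.
  - have [|A FA _] := stO ((s + t) / 2); first lra.
    by exists A.
  - by move=> A /FP[].
  - by move=> u /=; rewrite in_itv/= => uI; apply: stO; lra.
have [oA A01 AP] := FP _ FA.
have cA : closed (~` A) by exact: open_closedC.
have nAs : (~` A) s by move=> As; apply: Os; exists A.
have nAt : (~` A) t by move=> As; apply: Ot; exists A.
have [|s1 [As1 s1h s1P]] := @closed_last _ _ s (s + h) cA nAs; first lra.
have [|t1 [At1 t1h t1P]] := @closed_first _ _ (t - h) t cA nAt; first lra.
have p1 : p s1 = p t1.
  apply: AP => //; first lra.
  move=> u us; have [uh|uh] := leP u (s + h).
    by apply: contrapT; apply: s1P; lra.
  have [ut|ut] := leP (t - h) u.
    by apply: contrapT; apply: t1P; lra.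
  by apply: hA; rewrite /= in_itv/=; lra.
have := d1P s1; have := d2P t1; rewrite -p1 => /(_ _)/ltW h4 /(_ _)/ltW h5.
apply: (le_trans (metric_triangle _ (p s1) _)).
rewrite (splitr e) (metric_sym (p s1)); apply: lerD; [apply: h5|apply: h4].
  by rewrite ler0_norm; lra.
by rewrite ger0_norm; lra.
Qed.

Definition monotone_path (q : R -> X) := forall s u t,
  0 <= s -> s <= u -> u <= t -> t <= 1 -> q s = q t -> q u = q s.

(** For a maximal set [O] of gaps, given by Zorn's lemma, [q] is [p \o l], where [l t] is the last
    parameter up to [t] outside [O]. Thus [q] waits at the left end of each gap. *)
Lemma path_monotone_path (p : R -> X) : continuous p ->
  exists q : R -> X, [/\ continuous q, q 0 = p 0, q 1 = p 1, monotone_path q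
    & forall t, 0 <= t <= 1 -> exists2 s, 0 <= s <= 1 & q t = p s].
Proof.
move=> cp.
have [ O [[oO O01 OP] Omax]] := Zorn_bigcup (fun F => @loop_gaps_chain p F cp).
have cK : closed (~` O) by exact: open_closedC.
have nO0 : ~ O 0 by move=> /O01 /=; rewrite ltxx.
have nO1 : ~ O 1 by move=> /O01 /=; rewrite ltxx andbF.
have /choice[l lP] : forall t, exists l, [/\ ~ O l, l <= t &
    forall u, l < u -> u <= t -> O u].
  move=> t; have [t0|t0] := leP 0 t.
    have [l [Kl /andP[_ lt] lP]] := closed_last cK nO0 t0.
    by exists l; split => // u /lP/[apply]/contrapT.
  exists t; split => //; first by move=> /O01 /=; lra.
  by move=> u tu ut; have := lt_le_trans tu ut; rewrite ltxx.
have lK t : ~ O t -> l t = t.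
  move=> nOt; have [_ + lO] := lP t; rewrite le_eqVlt => /predU1P[//|lt].
  by case: nOt; exact: lO.
have lge k t : ~ O k -> k <= t -> k <= l t.
  move=> nOk kt; rewrite leNgt; apply/negP => lk.
  by case: nOk; have [_ _ lO] := lP t; exact: lO.
have lmono s t : s <= t -> l s <= l t.
  by move=> st; have [nO ls _] := lP s; apply: lge => //; exact: le_trans st.
exists (p \o l); split.
- apply/continuous_mdist => t e e0 /=.
  have [d d0 dP] := (continuous_mdist p).1 cp (l t) _ e0.
  have [Ot|nOt] := pselect (O t).
    have [r r0 rP] := (open_real O).1 oO t Ot.
    exists r => // s ts; have -> : l s = l t; last by rewrite mdistxx.
    have [nOl lt lO] := lP t; have [nOs ls sO] := lP s.
    apply/eqP; rewrite eq_le; apply/andP; split.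
      apply: lge => //; rewrite leNgt; apply/negP => tl; apply: nOs; apply: rP.
      by move/ltr_normlP: ts => [] *; apply/ltr_normlP; split; lra.
    apply: lge => //; rewrite leNgt; apply/negP => sl; apply: nOl; apply: rP.
    by move/ltr_normlP: ts => [] *; apply/ltr_normlP; split; lra.
  have ltE := lK t nOt; rewrite ltE in dP *.
  have [[k [nOk kt tk]]|nk] := pselect (exists k, [/\ ~ O k, k < t & t - d < k]).
    exists (Num.min d (t - k)); first by rewrite lt_min d0 subr_gt0.
    move=> s; rewrite lt_min => /andP[/ltr_normlP[h1 h2] /ltr_normlP[h3 h4]].
    have [nOs ls sO] := lP s; apply: dP; apply/ltr_normlP.
    have kls : k <= l s by apply: lge => //; lra.
    by split; lra.
  (* Here [t] is the right end of a gap, where [l] jumps; [q] does not, because [p] agrees at both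
     ends of the gap. *)
  pose m := t - d / 2.
  have [nOm lm mO] := lP m.
  exists (d / 2); first by rewrite divr_gt0.
  move=> s /ltr_normlP[h1 h2]; have [nOs ls sO] := lP s.
  have [ts|st] := leP t s.
    have := lge t s nOt ts.
    by move=> tl; apply: dP; apply/ltr_normlP; split; lra.
  have tO u : t - d < u -> u < t -> O u.
    by move=> du ut; apply: contrapT => nOu; apply: nk; exists u.
  have lsE : l s <= t - d.
    by rewrite leNgt; apply/negP => /tO /(_ (le_lt_trans ls st)).
  have -> : p (l s) = p t; last by rewrite mdistxx.
  apply: OP => //; first exact: le_lt_trans st.
  move=> u /andP[su ut]; have [us|us] := leP u s; first exact: sO.
  by apply: tO => //; lra.
- by rewrite /= lK.
- by rewrite /= lK.
- move=> s u t s0 su ut t1 /= st.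
  have [nOs ls sO] := lP s; have [nOt lt tO] := lP t; have [nOu lu uO] := lP u.
  have l0 : 0 <= l s by exact: lge.
  have l1 : l t <= 1 by exact: le_trans t1.
  have lsu := lmono _ _ su; have lut := lmono _ _ ut.
  have [stO|/existsNP[v]] := pselect (forall v, l s < v < l t -> O v).
    have : l u = l s \/ l u = l t.
      move: lsu; rewrite le_eqVlt => /predU1P[->|lsu]; first by left.
      move: lut; rewrite le_eqVlt => /predU1P[->|lut]; first by right.
      by case: nOu; apply: stO; rewrite lsu.
    by case=> ->.
  move=> /not_implyP[sv nOv].
  (* Adding the whole interval from [l s] to [l t], which contains [v], gives a strictly larger set
     of gaps, against maximality. *)
  pose O' := O `|` [set w | l s < w < l t].
  have : loop_gaps p O'.
    split.
    + apply: openU => //; have := @interval_open R (BRight (l s)) (BLeft (l t)).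
      have -> : [set` Interval (BRight (l s)) (BLeft (l t))] = [set w | l s < w < l t].
        by apply/seteqP; split => w /=; rewrite in_itv.
      exact.
    + by move=> w [/O01//|/= ?]; lra.
    + move=> a b ab nOa nOb abO.
      have nOa1 : ~ O a by move=> ?; apply: nOa; left.
      have nOb1 : ~ O b by move=> ?; apply: nOb; left.
      have nSa : ~ (l s < a < l t) by move=> ?; apply: nOa; right.
      have nSb : ~ (l s < b < l t) by move=> ?; apply: nOb; right.
      have nsO' : ~ O' (l s) by case=> //=; rewrite ltxx.
      have ntO' : ~ O' (l t) by case=> //=; rewrite ltxx andbF.
      have nns : ~ (a < l s < b) by move=> /abO.
      have nnt : ~ (a < l t < b) by move=> /abO.
      have [asE|asE] := eqVneq a (l s).
        have [bt | bt] := eqVneq b (l t); first by rewrite asE bt.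
        have [bt'|bt'] := ltP b (l t); first by case: nSb; rewrite bt' -asE ab.
        have tb : l t < b by rewrite lt_neqAle eq_sym bt.
        by case: nnt; rewrite asE tb andbT; lra.
      apply: OP => // w wab; have [//|/= sw] := abO w wab.
      case: nSa; have [asl|las] := ltP a (l s).
        by case: nns; rewrite asl; lra.
      have sa : l s < a by rewrite lt_neqAle eq_sym asE.
      by rewrite sa /=; lra.
  move=> lO'; exfalso; apply: (Omax O') lO'; split; first by left.
  move=> OO; apply: nOv; have Ov : O' v by right.
  exact: (OO v Ov).
- move=> t /andP[t0 t1]; exists (l t) => //; have [_ lt _] := lP t.
  by apply/andP; split; [exact: lge|exact: le_trans t1].
Qed.

End MonotonePath.

(** * Reparametrizing a monotone path to an arc *)

Section InjectivePath.
Context (R : realType) (X : metricType R).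

Lemma exists_dense_seq : exists r : nat -> R, forall t (d : R), 0 < d ->
  exists n, `|t - r n| < d.
Proof.
exists (fun n => if unpickle n is Some z then ratr (z : rat) else 0) => t d d0.
have [|z] := @rat_in_itvoo R (t - d) (t + d); first lra.
rewrite in_itv/= => /andP[h1 h2].
exists (pickle z); rewrite pickleK.
by apply/ltr_normlP; split; lra.
Qed.

Section Height.
Variables (q : R -> X) (r : nat -> R).
Hypothesis cq : continuous q.
Hypothesis r_dense : forall t (d : R), 0 < d -> exists n, `|t - r n| < d.
Hypothesis mq : monotone_path q.

(** [m n t] is the distance from [q (r n)] to the part of the path run through up to time [t]. It is
    at most the distance to [q 0], so the weight [w n] bounds the term of index [n] by 2^-n for all
    [t]. The terms being nonnegative, the supremum of the partial sums is the sum of the series. *)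
Let m n t := inf [set mdist (q (r n)) (q s) | s in [set s | 0 <= s <= clip t]].
Let w n := 2^-1 ^+ n / (1 + mdist (q (r n)) (q 0)).
Let S N t := \sum_(k < N) w k * m k t.
Definition path_height t := - sup [set S N t | N in setT].
Let phi := path_height.

Let w_gt0 n : 0 < w n.
Proof. by rewrite divr_gt0 ?exprn_gt0// ltr_wpDr// mdist_ge0. Qed.

Let w_le n : w n <= 2^-1 ^+ n.
Proof.
rewrite /w ler_pdivrMr; last by rewrite ltr_wpDr// mdist_ge0.
by rewrite ler_peMr ?exprn_ge0// lerDl mdist_ge0.
Qed.

Let m_le n s t : 0 <= s <= clip t -> m n t <= mdist (q (r n)) (q s).
Proof.
move=> st; apply: ge_inf; last by exists s.
by exists 0 => _ [u _ <-]; exact: mdist_ge0.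
Qed.

Let m_ge n t c : (forall s, 0 <= s <= clip t -> c <= mdist (q (r n)) (q s)) ->
  c <= m n t.
Proof.
move=> h; apply: lb_le_inf; last by move=> _ [s st <-]; exact: h.
by exists (mdist (q (r n)) (q 0)), 0 => //=; rewrite lexx; have /andP[] := clip_itv t.
Qed.

Let m_ge0 n t : 0 <= m n t.
Proof. by apply: m_ge => s _; exact: mdist_ge0. Qed.

Let sum_half N : \sum_(k < N) (2^-1 : R) ^+ k <= 2.
Proof.
suff -> : \sum_(k < N) (2^-1 : R) ^+ k = 2 - 2 * 2^-1 ^+ N.
  by rewrite lerBlDr lerDl mulr_ge0// exprn_ge0.
elim: N => [|N IHN]; first by rewrite big_ord0 expr0 mulr1 subrr.
by rewrite big_ord_recr/= IHN exprS; field.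
Qed.

Let S_le2 N t : S N t <= 2.
Proof.
apply: le_trans (sum_half N); apply: ler_sum => k _.
rewrite /w -mulrA ler_piMr ?exprn_ge0// mulrC ler_pdivrMr ?mul1r.
  apply: (@le_trans _ _ (mdist (q (r k)) (q 0))); last by rewrite lerDr.
  by apply: m_le; rewrite lexx; have /andP[] := clip_itv t.
by rewrite ltr_wpDr// mdist_ge0.
Qed.

Let S_has_sup t : has_sup [set S N t | N in setT].
Proof. by split; [exists (S 0 t), 0%N|exists 2 => _ [N _ <-]; exact: S_le2]. Qed.

Let S_le N t : S N t <= - phi t.
Proof. by rewrite opprK; apply: ub_le_sup; [exact: (S_has_sup t).2|exists N]. Qed.

Let phi_ge t c : (forall N, S N t <= c) -> - c <= phi t.
Proof.
move=> h; rewrite lerN2; apply: ge_sup; first exact: (S_has_sup t).1.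
by move=> _ [N _ <-].
Qed.

Let m_mono n s t : s <= t -> m n t <= m n s.
Proof.
move=> st; apply: m_ge => u /andP[u0 us]; apply: m_le.
by rewrite u0 (le_trans us)// le_clip.
Qed.

Lemma path_height_le s t : s <= t -> phi s <= phi t.
Proof.
move=> st; rewrite -[phi s]opprK; apply: phi_ge => N; apply: le_trans (S_le N s).
by apply: ler_sum => k _; rewrite ler_pM2l//; exact: m_mono.
Qed.

Let m_close n s t (e : R) : s <= t ->
  (forall u, clip s <= u <= clip t -> mdist (q (clip s)) (q u) <= e) ->
  m n s <= m n t + e.
Proof.
move=> st h; rewrite -lerBlDr; apply: m_ge => u /andP[u0 ut].
have [us|su] := leP u (clip s).
  rewrite lerBlDr (@le_trans _ _ (mdist (q (r n)) (q u)))//.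
    by apply: m_le; rewrite u0.
  rewrite lerDl; apply: le_trans (h (clip s) _); first exact: mdist_ge0.
  by rewrite lexx le_clip.
have : m n s <= mdist (q (r n)) (q (clip s)).
  by apply: m_le; rewrite lexx; have /andP[->] := clip_itv s.
have := metric_triangle (q (r n)) (q u) (q (clip s)).
have : mdist (q (clip s)) (q u) <= e by apply: h; rewrite ltW.
by rewrite (metric_sym (q u) (q (clip s))); lra.
Qed.

(** Adding points within [e] of [q (clip s)] to the part already run through lowers each distance by
    at most [e], and the weights sum to at most 2. *)
Let phi_close s t (e : R) : s <= t ->
  (forall u, clip s <= u <= clip t -> mdist (q (clip s)) (q u) <= e) ->
  phi t <= phi s + 2 * e.
Proof.
move=> st h.
have e0 : 0 <= e.
  by apply: le_trans (h (clip s) _); [exact: mdist_ge0|rewrite lexx le_clip].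
have : - (- phi t + 2 * e) <= phi s.
  apply: phi_ge => N; apply: (@le_trans _ _ (S N t + 2 * e)); last first.
    by rewrite lerD2r.
  apply: (@le_trans _ _ (S N t + (\sum_(k < N) 2^-1 ^+ k) * e)).
    rewrite mulr_suml -big_split /=; apply: ler_sum => k _.
    apply: (@le_trans _ _ (w k * (m k t + e))).
      by rewrite ler_pM2l//; exact: m_close.
    by rewrite mulrDr lerD2l ler_wpM2r.
  by rewrite lerD2l ler_wpM2r.
lra.
Qed.

Lemma path_height_continuous : continuous phi.
Proof.
suff half t (e : R) : 0 < e -> exists2 d, 0 < d & forall s, `|t - s| < d ->
    `|phi t - phi s| <= e.
  move=> t; apply/cvgrPdist_lt => e e0.
  have [|d d0 dP] := half t (e / 2); first by rewrite divr_gt0.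
  by apply/nbhs_ballP; exists d => // s /dP /le_lt_trans; apply; lra.
move=> e0; have e40 : 0 < e / 4 by rewrite divr_gt0.
have [d d0 dP] := (continuous_mdist q).1 cq (clip t) _ e40.
exists d => // s ts.
have clt : `|clip t - clip s| < d by apply: le_lt_trans ts; exact: clip_lipschitz.
have [st|/ltW st] := leP t s.
  rewrite distrC ger0_norm ?subr_ge0 ?path_height_le//.
  suff : phi s <= phi t + 2 * (e / 4) by lra.
  apply: phi_close => // u /andP[tu us]; apply/ltW/dP.
  by move/ltr_normlP: clt => [] *; apply/ltr_normlP; split; lra.
rewrite ger0_norm ?subr_ge0 ?path_height_le//.
suff : phi t <= phi s + 2 * (e / 2) by lra.
apply: phi_close => // u /andP[su ut].
have h1 : mdist (q (clip t)) (q u) < e / 4.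
  by apply: dP; move/ltr_normlP: clt => [] *; apply/ltr_normlP; split; lra.
have := dP _ clt; have := metric_triangle (q (clip s)) (q (clip t)) (q u).
by rewrite (metric_sym (q (clip s)) (q (clip t))); lra.
Qed.

(* If q t is not in q [0, s] and r_n is close to t, the n-th distance drops. *)
Lemma path_height_eq s t : 0 <= s -> s <= t -> t <= 1 ->
  phi s = phi t <-> q s = q t.
Proof.
move=> s0 st t1.
have sE : clip s = s by apply: clip_id; lra.
have tE : clip t = t by apply: clip_id; lra.
split=> [pst|qst]; last first.
  apply/eqP; rewrite eq_le path_height_le//=.
  have : phi t <= phi s + 2 * 0; last by rewrite mulr0 addr0.
  apply: phi_close => // u; rewrite sE tE => /andP[su ut].
  by rewrite (mq s0 su ut t1 qst) mdistxx.
apply: contrapT => nst.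
(* By monotonicity, a value [q u] with [u <= s] equal to [q t] would force [q s = q t]; so [q t]
   lies off the compact set q [0, s]. *)
have [e e0 eP] : exists2 e : R, 0 < e & forall u, 0 <= u <= s -> e <= mdist (q t) (q u).
  have cK : compact (q @` `[0, s]).
    by apply: continuous_compact; [exact: continuous_subspaceT|exact: segment_compact].
  have clK := compact_closed (@metric_hausdorff _ X) cK.
  have [|e e0 eP] := (open_mdist _).1 (closed_openC clK) (q t).
    move=> [u /=]; rewrite in_itv/= => /andP[u0 us] qut; apply: nst.
    by rewrite -qut; apply: (mq u0 us st t1).
  exists e => // u us; rewrite leNgt; apply/negP => /eP; apply.
  by exists u; rewrite //= in_itv.
have e20 : 0 < e / 2 by rewrite divr_gt0.
have [d d0 dP] := (continuous_mdist q).1 cq t _ e20.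
have [n nP] := r_dense t d0.
have rn := dP _ nP.
have mt : m n t < e / 2.
  apply: (@le_lt_trans _ _ (mdist (q (r n)) (q t))); last by rewrite metric_sym.
  by apply: m_le; rewrite tE; lra.
have ms : e / 2 <= m n s.
  apply: m_ge => u; rewrite sE => /eP.
  by have := metric_triangle (q t) (q (r n)) (q u); lra.
(* From [s] to [t], the term of index [n] drops by this amount and no other term increases. *)
have c0 : 0 < w n * (m n s - m n t) by rewrite mulr_gt0// subr_gt0; lra.
suff : - (- phi s - w n * (m n s - m n t)) <= phi t by lra.
apply: phi_ge => N; rewrite lerBrDr.
(* The partial sum is extended far enough to contain the term of index [n]. *)
apply: le_trans (S_le (maxn N n.+1) s).
apply: (@le_trans _ _ (S (maxn N n.+1) t + w n * (m n s - m n t))).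
  rewrite lerD2r /S -!(big_mkord xpredT (fun k => w k * m k t)).
  rewrite [leRHS](big_cat_nat (n := N))//= ?leq_maxl// lerDl.
  by apply: sumr_ge0 => k _; rewrite mulr_ge0// ltW.
have nN : (n < maxn N n.+1)%N by rewrite leq_max ltnSn orbT.
pose rest u := \sum_(i < maxn N n.+1 | i != Ordinal nN) w i * m i u.
have SE u : S (maxn N n.+1) u = w n * m n u + rest u by rewrite /S (bigD1 (Ordinal nN)).
have rst : rest t <= rest s.
  by apply: ler_sum => k _; rewrite ler_pM2l//; exact: m_mono.
by rewrite !SE mulrBr addrC addrA subrK lerD2l.
Qed.

End Height.

End InjectivePath.

Section ArcPath.
Context (R : realType) (X : metricType R).

Definition arc_path (al : R -> X) :=
  continuous al /\ forall s t, 0 <= s <= 1 -> 0 <= t <= 1 -> al s = al t -> s = t.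

(** On [0, 1], [phi] identifies exactly the parameters that [q] identifies. Hence [q] factors
    through the normalized height [nrm], and [T], a right inverse of [nrm] on [0, 1], makes [q \o T]
    injective. *)
Lemma path_in_arc_path U x y : x <> y -> path_in U x y ->
  exists al : R -> X, [/\ arc_path al, al 0 = x, al 1 = y
    & forall t, 0 <= t <= 1 -> U (al t)].
Proof.
move=> xy [p [cp p0 p1 pU]].
have [q [cq q0 q1 mq qp]] := path_monotone_path cp.
have [r rP] := exists_dense_seq R.
pose phi := path_height q r.
have cphi : continuous phi by exact: path_height_continuous.
have phiE s t : 0 <= s <= 1 -> 0 <= t <= 1 -> phi s = phi t <-> q s = q t.
  move=> /andP[s0 s1] /andP[t0 t1]; have [st|/ltW st] := leP s t.
    exact: path_height_eq.
  by split=> [/esym/path_height_eq ->//|/esym qts]; apply/esym/path_height_eq.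
have i0 : 0 <= (0:R) <= 1 by rewrite lexx ler01.
have i1 : 0 <= (1:R) <= 1 by rewrite lexx ler01.
have L0 : phi 0 < phi 1.
  rewrite lt_neqAle path_height_le// andbT; apply/eqP => /(phiE _ _ i0 i1).
  by rewrite q0 q1 p0 p1.
have /choice[T TP] : forall v, exists t : R, 0 <= t <= 1 /\
    phi t = phi 0 + clip v * (phi 1 - phi 0).
  move=> v; have [|||t] := @IVT R phi 0 1 (phi 0 + clip v * (phi 1 - phi 0)).
  - exact: ler01.
  - exact: continuous_subspaceT.
  - have /andP[v0 v1] := clip_itv v.
    rewrite (min_l (ltW L0)) (max_r (ltW L0)).
    have d0 : 0 <= phi 1 - phi 0 by rewrite subr_ge0 ltW.
    have := mulr_ge0 v0 d0; have := ler_piMl d0 v1.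
    by move: (clip v * _) => c ? ?; apply/andP; split; lra.
  by rewrite in_itv/= => t01 tE; exists t.
pose nrm (t : R) : R := (phi t - phi 0) / (phi 1 - phi 0).
have L0' : phi 1 - phi 0 != 0 by rewrite subr_eq0 gt_eqF.
have nrmT v : nrm (T v) = clip v.
  by have [_ tE] := TP v; rewrite /nrm tE addrC addKr mulfK.
exists (q \o T); split.
- split; last first.
    move=> s t s01 t01 /= qst.
    have [Ts _] := TP s; have [Tt _] := TP t.
    have pst := (phiE _ _ Ts Tt).2 qst.
    by have := nrmT s; have := nrmT t; rewrite /nrm pst => ->; rewrite !clip_id.
  (* [T] itself may be discontinuous. The preimage of a closed [D] is described instead by the image
     under [nrm] of a compact set of parameters. *)
  apply/continuous_closedP => D cD.
  pose K := (nrm @` (`[0, 1] `&` q @^-1` D)).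
  have -> : (q \o T) @^-1` D = @clip R @^-1` K.
    apply/seteqP; split => [v /= Dv|v /= [t [/= t01 Dt] tv]].
      by exists (T v) => //; split => //=; rewrite in_itv/=; have [] := TP v.
    rewrite in_itv/= in t01.
    have [T01 _] := TP v; suff <- : q t = q (T v) by [].
    apply/phiE => //; have := nrmT v; rewrite -tv /nrm => /(congr1 ( *%R^~ (phi 1 - phi 0))).
    by rewrite /= !divfK// => /addIr.
  apply: closed_comp; first by move=> v _; exact: clip_continuous.
  apply: compact_closed; first exact: Rhausdorff.
  apply: continuous_compact.
    apply: continuous_subspaceT => t.
    apply: cvgM; last exact: cvg_cst.
    by apply: cvgB; [exact: cphi|exact: cvg_cst].
  apply: compact_closedI; first exact: segment_compact.
  by apply: closed_comp => // t _; exact: cq.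
- have [T01 TE] := TP 0; rewrite /= -p0 -q0; apply/phiE => //.
  by rewrite TE clip_id// mul0r addr0.
- have [T01 TE] := TP 1; rewrite /= -p1 -q1; apply/phiE => //.
  by rewrite TE clip_id// mul1r addrC subrK.
- by move=> t _ /=; have [T01 _] := TP t; have [s s01 ->] := qp _ T01; exact: pU.
Qed.

End ArcPath.

(** * Arcs and simple closed curves as subspaces *)

Section CompactHomeo.

Lemma nbhs_set_type (T : topologicalType) (A : set T) (x : A) (U : set A) :
  nbhs x U <-> exists2 V : set T, nbhs (set_val x) V & set_val @^-1` V `<=` U.
Proof.
split=> [[_ [/= [W oW <-] Wx] WU]|[V nV VU]].
  by exists W => //; apply: open_nbhs_nbhs.
apply: filterS VU _.
by have := @initial_continuous A T set_val x; apply.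
Qed.

Lemma compact_set_type (T : topologicalType) (A : set T) :
  compact A -> compact [set: set_type A].
Proof.
move=> cA F PF _.
have [|p [Ap clp]] := cA (set_val @ F).
  suff : F (set_val @^-1` A) by [].
  by apply: (filterS _ filterT) => x _; exact: set_valP.
exists (exist _ p (mem_set Ap)); split => // P Q FP /nbhs_set_type[V nV VQ].
have [||_ [[x Px <-] Vx]] := clp (set_val @` P) V.
- suff : F (set_val @^-1` (set_val @` P)) by [].
  by apply: (filterS _ FP) => x Px; exists x.
- by rewrite set_valE in nV.
by exists x; split => //; exact: VQ.
Qed.

Lemma compact_homeomorphic_range (K X : topologicalType) (g : K -> X) :
  compact [set: K] -> hausdorff_space X -> continuous g -> injective g ->
  homeomorphic K (set_type (range g)).
Proof.
move=> cK hX cg ig.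
have rg t : g t \in range g by apply/mem_set; exists t.
have /choice[h hP] : forall v : set_type (range g), exists t, g t = set_val v.
  by move=> v; have [t _ tv] := set_valP v; exists t.
exists (fun t => exist _ (g t) (rg t)), h; split.
- by apply: continuous_comp_initial => t; exact: cg.
- apply/continuous_closedP => D cD.
  have cgD : closed (g @` D).
    apply: compact_closed => //; apply: continuous_compact.
      exact: continuous_subspaceT.
    by rewrite -[D]setTI; exact: compact_closedI.
  have -> : h @^-1` D = set_val @^-1` (g @` D).
    apply/seteqP; split => [v /= Dv|v /= [t Dt tv]]; first by exists (h v).
    by rewrite -hP in tv; rewrite -(ig _ _ tv).
  by apply: closed_comp => // v _; exact: initial_continuous.
- by move=> t; apply: ig; rewrite hP.
- by move=> v; apply: val_inj; rewrite /= hP.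
Qed.

End CompactHomeo.

Section Circle.
Context (R : realType) (X : metricType R).

Lemma arc_path_is_arc (al : R -> X) : arc_path al -> is_arc (al @` `[0, 1]).
Proof.
move=> [cal ial]; rewrite /is_arc.
pose I := `[0, 1]%classic : set R.
have -> : al @` `[0, 1] = range (fun t : set_type I => al (set_val t)).
  apply/seteqP; split => [_ [t t01 <-]|_ [t _ <-]].
    by exists (exist _ t (mem_set t01)).
  by exists (set_val t) => //; exact: set_valP.
apply: compact_homeomorphic_range.
- by apply: compact_set_type; exact: segment_compact.
- exact: metric_hausdorff.
- by move=> t; apply: continuous_comp; [exact: initial_continuous|exact: cal].
- move=> s t /ial st; apply: val_inj; apply: st.
  + by have := set_valP s; rewrite /I /= in_itv.
  + by have := set_valP t; rewrite /I /= in_itv.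
Qed.

Lemma sqr_le1_itv (a : R) : a ^+ 2 <= 1 -> -1 <= a <= 1.
Proof.
by rewrite -ler_norml -(@expr_le1 _ 2 `|a|) ?normr_ge0// real_normK ?num_real.
Qed.

Lemma unit_circle_compact : compact (unit_circle R).
Proof.
apply: (@subclosed_compact _ _ ((`[-1, 1]%classic : set R) `*` (`[-1, 1]%classic : set R))).
- apply: (@closed_comp _ _ (fun p : R * R => p.1 ^+ 2 + p.2 ^+ 2) [set 1 : R]).
    move=> p _; apply: cvgD; rewrite expr2; apply: cvgM.
    + exact: cvg_fst.
    + exact: cvg_fst.
    + exact: cvg_snd.
    + exact: cvg_snd.
  by apply: compact_closed; [exact: Rhausdorff|exact: compact_set1].
- by apply: compact_setX; exact: segment_compact.
- move=> [a b] /= ab; rewrite /unit_circle/= in ab.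
  have a2 : a ^+ 2 <= 1 by rewrite -ab lerDl sqr_ge0.
  have b2 : b ^+ 2 <= 1 by rewrite -ab lerDr sqr_ge0.
  by split; rewrite /= in_itv /=; exact: sqr_le1_itv.
Qed.

(** Through the first coordinate, the lower half of the circle is mapped onto [be] and the upper
    half, in the opposite direction, onto [al]; the points (1, 0) and (-1, 0) go to the common
    ends. *)
Lemma two_arcs_simple_closed_curve (al be : R -> X) : arc_path al -> arc_path be ->
  al 0 = be 1 -> al 1 = be 0 ->
  (forall s t, 0 <= s <= 1 -> 0 <= t <= 1 -> al s = be t ->
     (s = 0 /\ t = 1) \/ (s = 1 /\ t = 0)) ->
  exists A : set X, is_simple_closed_curve A.
Proof.
move=> [cal ial] [cbe ibe] ab0 ab1 dis.
pose K := set_type (unit_circle R).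
pose u (p : K) : R := (set_val p).1.
pose v (p : K) : R := (set_val p).2.
have uv p : u p ^+ 2 + v p ^+ 2 = 1 by have := set_valP p.
have cu : continuous u.
  by move=> p; apply: continuous_comp; [exact: initial_continuous|exact: cvg_fst].
have cv : continuous v.
  by move=> p; apply: continuous_comp; [exact: initial_continuous|exact: cvg_snd].
have u1 p : -1 <= u p <= 1.
  by apply: sqr_le1_itv; rewrite -(uv p) lerDl sqr_ge0.
pose g (p : K) := if v p <= 0 then be (2^-1 * u p + 2^-1) else al (- 2^-1 * u p + 2^-1).
have uv_eq p q : u p = u q -> v p = v q -> p = q.
  by case: p q => [[a b] p] [[c d] q] /= ac bd; apply: val_inj; rewrite /= /u /v/= in ac bd *; rewrite ac bd.
have sq p q : u p = u q -> v p = v q \/ v p = - v q.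
  move=> E; have : v p ^+ 2 = v q ^+ 2.
    by have := uv p; have := uv q; rewrite E; lra.
  by move/eqP; rewrite eqf_sqr => /orP[] /eqP; [left|right].
have vp0 p : v p = 0 -> u p = 1 \/ u p = -1.
  move=> v0; have : u p ^+ 2 = 1 ^+ 2.
    by have := uv p; rewrite v0 expr0n addr0 expr1n.
  by move/eqP; rewrite eqf_sqr => /orP[] /eqP; [left|right].
have v1 p : u p = 1 \/ u p = -1 -> v p = 0.
  move=> h; apply/eqP; rewrite -sqrf_eq0; apply/eqP.
  by have := uv p; case: h => ->; lra.
exists (range g); apply: compact_homeomorphic_range.
- by apply: compact_set_type; exact: unit_circle_compact.
- exact: metric_hausdorff.
- apply: continuous_if => //.
  + by move=> p; apply: (@continuous_comp _ _ _ u (fun t => be (2^-1 * t + 2^-1))); [exact: cu|exact: continuous_comp_affine].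
  + by move=> p; apply: (@continuous_comp _ _ _ u (fun t => al (- 2^-1 * t + 2^-1))); [exact: cu|exact: continuous_comp_affine].
  + move=> p /vp0[] ->.
      by rewrite [X in be X](_ : _ = 1) ?[X in al X](_ : _ = 0) ?ab0//; lra.
    by rewrite [X in be X](_ : _ = 0) ?[X in al X](_ : _ = 1) ?ab1//; lra.
- move=> p q; rewrite /g.
  have := u1 p; have := u1 q => q1 p1.
  case: ifP => vp; case: ifP => vq.
  + move/ibe => E; apply: uv_eq; first by have := E ltac:(lra) ltac:(lra); lra.
    have /sq[//|vpq] : u p = u q by have := E ltac:(lra) ltac:(lra); lra.
    by lra.
  + move/esym/dis => /(_ ltac:(lra) ltac:(lra)) E.
    have /v1 v0 : u q = 1 \/ u q = -1 by case: E => -[? ?]; [left|right]; lra.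
    by move: vq; rewrite v0 lexx.
  + move/dis => /(_ ltac:(lra) ltac:(lra)) E.
    have /v1 v0 : u p = 1 \/ u p = -1 by case: E => -[? ?]; [left|right]; lra.
    by move: vp; rewrite v0 lexx.
  + move/ial => E; apply: uv_eq; first by have := E ltac:(lra) ltac:(lra); lra.
    have /sq[//|vpq] : u p = u q by have := E ltac:(lra) ltac:(lra); lra.
    by move/negbT: vp; move/negbT: vq; rewrite -!ltNge => ? ?; lra.
Qed.

End Circle.

(** An intersection of connected sets involves no choice of a parametrization; for dendrites
    [seg_arc_path] identifies it with the arc. *)
Definition seg (T : topologicalType) (a b : T) : set T :=
  [set x | forall C : set T, connected C -> C a -> C b -> C x].

Section LocallyConnected.
Context (R : realType) (X : metricType R).

Lemma open_connected_component (U : set X) x : is_locally_connected X -> open U ->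
  open (connected_component U x).
Proof.
move=> lX oU; rewrite openE => y [C [Cx CU cC] Cy].
have nU : nbhs y U by apply: open_nbhs_nbhs; split => //; exact: CU.
have [V [oV cV Vy VU]] := lX y U nU.
apply: (@filterS _ _ _ V); last by apply: open_nbhs_nbhs.
move=> z Vz; exists (C `|` V); last by right.
split; first by left.
- by move=> w [/CU|/VU].
- by apply: connectedU => //; exists y.
Qed.

Lemma open_setC1 (x : X) : open (~` [set x]).
Proof. by apply: closed_openC; apply: compact_closed; [exact: metric_hausdorff|exact: compact_set1]. Qed.

Lemma arc_path_comp_affine (al : R -> X) (a b : R) : arc_path al -> a != 0 ->
  0 <= b <= 1 -> 0 <= a + b <= 1 -> arc_path (fun t => al (a * t + b)).
Proof.
move=> [cal ial] a0 b01 ab01; split; first exact: continuous_comp_affine.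
have st01 t : 0 <= t <= 1 -> 0 <= a * t + b <= 1.
  move=> /andP[t0 t1]; have [ap|an] := leP 0 a.
    by have := mulr_ge0 ap t0; have := ler_piMr ap t1; lra.
  have an' : 0 <= - a by lra.
  by have := mulr_ge0 an' t0; have := ler_piMr an' t1; lra.
move=> s t /st01 s01 /st01 t01 /(ial _ _ s01 t01) /addIr.
exact: mulfI.
Qed.

End LocallyConnected.

(** * Uniqueness of arcs in a dendrite *)

Section Dendrite.
Context (R : realType) (X : metricType R).
Hypothesis cX : compact [set: X].
Hypothesis lX : is_locally_connected X.
Hypothesis nC : forall A : set X, ~ is_simple_closed_curve A.

(** If [al t] is off [be], let [s1] and [s2] be the parameters nearest to [t] on either side at
    which [al] meets [be]. The piece of [al] between them and the piece of [be] with the same ends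
    form a simple closed curve. *)
Lemma arc_path_unique (al be : R -> X) (t : R) : arc_path al -> arc_path be ->
  al 0 = be 0 -> al 1 = be 1 -> 0 <= t <= 1 ->
  exists2 s : R, 0 <= s <= 1 & be s = al t.
Proof.
move=> hal hbe ab0 ab1 t01; have [cal ial] := hal; have [cbe ibe] := hbe.
pose B := be @` `[0, 1].
have cB : closed B.
  apply: compact_closed; first exact: metric_hausdorff.
  by apply: continuous_compact; [exact: continuous_subspaceT|exact: segment_compact].
have cK : closed (al @^-1` B) by apply: closed_comp => // w _; exact: cal.
apply: contrapT => nB.
have ntB : ~ (al @^-1` B) t.
  by move=> [w]; rewrite /= in_itv => w01 wt; apply: nB; exists w.
have K0 : (al @^-1` B) 0 by exists 0; rewrite /= ?in_itv/= ?lexx ?ler01.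
have K1 : (al @^-1` B) 1 by exists 1; rewrite /= ?in_itv/= ?lexx ?ler01.
have /andP[t0 t1] := t01.
have [s1 [Ks1 s1I s1P]] := closed_last cK K0 t0.
have [s2 [Ks2 s2I s2P]] := closed_first cK K1 t1.
have [w1] := Ks1; rewrite /= in_itv/= => w1I w1E.
have [w2] := Ks2; rewrite /= in_itv/= => w2I w2E.
have s1t : s1 < t.
  by rewrite lt_neqAle; case/andP: s1I => _ ->; rewrite andbT; apply/eqP => E; apply: ntB; rewrite -E.
have ts2 : t < s2.
  by rewrite lt_neqAle; case/andP: s2I => -> _; rewrite andbT; apply/eqP => E; apply: ntB; rewrite E.
have w12 : w1 <> w2.
  move=> E; have aE : al s1 = al s2 by rewrite -w1E E.
  by have := ial s1 s2 ltac:(real_lra R) ltac:(real_lra R) aE; real_lra R.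
have [|||||A] := @two_arcs_simple_closed_curve R X
    (fun u => al ((s2 - s1) * u + s1)) (fun u => be ((w1 - w2) * u + w2)).
- by apply: arc_path_comp_affine => //; real_lra R.
- by apply: arc_path_comp_affine => //; [rewrite subr_eq0; exact/eqP|real_lra R].
- by rewrite mulr0 add0r mulr1 subrK w1E.
- by rewrite mulr0 add0r mulr1 subrK w2E.
- move=> u v u01 v01 E.
  have d0 : 0 <= s2 - s1 by real_lra R.
  have /andP[u0 u1] := u01; have /andP[v0 v1] := v01.
  have uI : s1 <= (s2 - s1) * u + s1 <= s2.
    by have := mulr_ge0 d0 u0; have := ler_piMr d0 u1; real_lra R.
  have vI : 0 <= (w1 - w2) * v + w2 <= 1.
    have [h|/ltW h] := leP w2 w1.
      have h' : 0 <= w1 - w2 by real_lra R.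
      by have := mulr_ge0 h' v0; have := ler_piMr h' v1; real_lra R.
    have h' : 0 <= w2 - w1 by real_lra R.
    by have := mulr_ge0 h' v0; have := ler_piMr h' v1; real_lra R.
  have Ku : (al @^-1` B) ((s2 - s1) * u + s1).
    by exists ((w1 - w2) * v + w2); rewrite //= in_itv.
  have : (s2 - s1) * u + s1 = s1 \/ (s2 - s1) * u + s1 = s2.
    apply: contrapT => /not_orP[/eqP n1 /eqP n2].
    have [ut|tu] := leP ((s2 - s1) * u + s1) t.
      by apply: (s1P _ _ ut) => //; rewrite lt_neqAle eq_sym n1; real_lra R.
    by apply: (s2P _ (ltW tu)) => //; rewrite lt_neqAle n2; real_lra R.
  case=> uE; [left|right].
    have u00 : u = 0.
      have /eqP : (s2 - s1) * u = 0 by real_lra R.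
      by rewrite mulf_eq0 => /orP[/eqP ?|/eqP//]; real_lra R.
    split => //; move: E; rewrite uE -w1E => /esym/(ibe _ _ vI) vE.
    have /eqP : (w1 - w2) * (v - 1) = 0 by rewrite mulrBr; have := vE ltac:(real_lra R); real_lra R.
    by rewrite mulf_eq0 => /orP[/eqP ?|/eqP ?]; [case: w12|]; real_lra R.
  have u11 : u = 1.
    have /eqP : (s2 - s1) * (u - 1) = 0 by rewrite mulrBr; real_lra R.
    by rewrite mulf_eq0 => /orP[/eqP ?|/eqP ?]; real_lra R.
  split => //; move: E; rewrite uE -w2E => /esym/(ibe _ _ vI) vE.
  have /eqP : (w1 - w2) * v = 0 by have := vE ltac:(real_lra R); real_lra R.
  by rewrite mulf_eq0 => /orP[/eqP ?|/eqP //]; case: w12; real_lra R.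
exact: nC.
Qed.

(** If a connected set contained both ends but not [al t], the component of the complement of [al t]
    around it would be open and connected. It would contain a second arc between the ends that
    avoids [al t], against uniqueness. *)
Lemma seg_arc_path (al : R -> X) : arc_path al -> seg (al 0) (al 1) = al @` `[0, 1].
Proof.
move=> hal; have [cal ial] := hal; apply/seteqP; split => [x sx|_ [t /= + <-] C cC C0 C1].
  apply: sx; last 2 first.
  - by exists 0; rewrite /= ?in_itv/= ?lexx ?ler01.
  - by exists 1; rewrite /= ?in_itv/= ?lexx ?ler01.
  apply: connected_continuous_connected; last exact: continuous_subspaceT.
  exact: segment_connected.
rewrite in_itv/= => t01; apply: contrapT => nCt.
pose U := connected_component (~` [set al t]) (al 0).
have CU : C `<=` U.
  apply: connected_component_max => //.
  by move=> z Cz /= zt; apply: nCt; rewrite -zt.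
have oU : open U by apply: open_connected_component => //; exact: open_setC1.
have ne : al 0 <> al 1.
  by move=> E; have := ial 0 1 ltac:(real_lra R) ltac:(real_lra R) E; real_lra R.
have [be [hbe be0 be1 beU]] := path_in_arc_path ne
   (open_connected_path cX lX oU (@component_connected _ _ _) (CU _ C0) (CU _ C1)).
have [s s01 sE] := arc_path_unique hal hbe (esym be0) (esym be1) t01.
have := beU _ s01; rewrite sE => /connected_component_sub.
by apply.
Qed.

Hypothesis kX : connected [set: X].

Lemma seg_param (a b : X) : a <> b -> exists al : R -> X,
  [/\ arc_path al, al 0 = a, al 1 = b & seg a b = al @` `[0, 1]].
Proof.
move=> ab.
have [al [hal al0 al1 _]] := path_in_arc_path ab
   (open_connected_path cX lX openT kX I I).
by exists al; split => //; rewrite -(seg_arc_path hal) al0 al1.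
Qed.

End Dendrite.

(** * Segments and the order of a rooted dendrite *)

Section SegTrivial.
Context (T : topologicalType).
Implicit Types a b x y : T.

Lemma seg_l a b : seg a b a. Proof. by []. Qed.
Lemma seg_r a b : seg a b b. Proof. by []. Qed.

Lemma segC a b : seg a b = seg b a.
Proof. by apply/seteqP; split => x h C cC Ca Cb; exact: h. Qed.

Lemma seg_id a x : seg a a x -> x = a.
Proof. by move=> /(_ [set a]); apply => //; exact: connected1. Qed.

Lemma seg_sub (C : set T) a b : connected C -> C a -> C b -> seg a b `<=` C.
Proof. by move=> cC Ca Cb x; apply. Qed.

End SegTrivial.

Section SegCalculus.
Context (R : realType) (X : metricType R).
Hypothesis dX : is_dendrite X.
Implicit Types a b c m x y z : X.

(** Describing all subsegments at once reduces betweenness on [seg a b] to the order of the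
    parameters. *)
Lemma dendrite_arc a b : a <> b -> exists al : R -> X,
  [/\ arc_path al, al 0 = a, al 1 = b & forall s t, 0 <= s -> s <= t -> t <= 1 ->
     seg (al s) (al t) = al @` `[s, t]].
Proof.
have [[_ cX kX] lX nC] := dX.
move=> ab; have [al [hal al0 al1 sE]] := seg_param cX lX nC kX ab.
exists al; split => // s t s0; rewrite le_eqVlt => /predU1P[<- s1|st t1].
  apply/seteqP; split=> [x /seg_id ->|_ [u /= + <-]].
    by exists s; rewrite //= in_itv /= lexx.
  by rewrite in_itv/= => ? C _ Cs _; rewrite (_ : u = s)//; lra.
have hbe : arc_path (fun u => al ((t - s) * u + s)).
  by apply: arc_path_comp_affine => //; real_lra R.
have := seg_arc_path cX lX nC hbe; rewrite mulr0 add0r mulr1 subrK => ->.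
apply/seteqP; split => [_ [u /= + <-]|_ [u /= + <-]]; rewrite in_itv/= => u01.
  exists ((t - s) * u + s) => //; rewrite /= in_itv/=.
  have ts : 0 <= t - s by real_lra R.
  have /andP[u0 u1] := u01.
  by have := mulr_ge0 ts u0; have := ler_piMr ts u1; real_lra R.
have ts : 0 < t - s by real_lra R.
exists ((u - s) / (t - s)); last by rewrite mulrC divfK ?gt_eqF// subrK.
rewrite /= in_itv/= ler_pdivrMr//; apply/andP; split; last by real_lra R.
by apply: divr_ge0; real_lra R.
Qed.

Lemma seg_is_arc a b : a <> b -> is_arc (seg a b).
Proof.
move=> /dendrite_arc[al [hal <- <- sE]].
by rewrite sE ?lexx ?ler01//; exact: arc_path_is_arc.
Qed.

Lemma seg_connected a b : connected (seg a b).
Proof.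
have [->|/eqP ab] := eqVneq a b.
  suff -> : seg b b = [set b] by exact: connected1.
  by apply/seteqP; split => [x /seg_id//|x -> C].
have [al [[cal _] <- <- ->//]] := dendrite_arc ab.
apply: connected_continuous_connected; last exact: continuous_subspaceT.
exact: segment_connected.
Qed.

Lemma seg_closed a b : closed (seg a b).
Proof.
have [->|/eqP ab] := eqVneq a b.
  have -> : seg b b = [set b].
    by apply/seteqP; split => [x /seg_id//|x -> C].
  by apply: compact_closed; [exact: metric_hausdorff|exact: compact_set1].
have [al [[cal _] <- <- ->//]] := dendrite_arc ab.
apply: compact_closed; first exact: metric_hausdorff.
by apply: continuous_compact; [exact: continuous_subspaceT|exact: segment_compact].
Qed.

Lemma seg_incl a b x y : seg a b x -> seg a b y -> seg x y `<=` seg a b.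
Proof. by move=> ax ay; apply: seg_sub => //; exact: seg_connected. Qed.

Lemma seg_cover a b x : seg a b `<=` seg a x `|` seg x b.
Proof.
apply: seg_sub; [|by left|by right].
by apply: connectedU; [exists x; split|exact: seg_connected|exact: seg_connected].
Qed.

Lemma seg_meet a b x y : seg a b x -> seg a x y -> seg x b y -> y = x.
Proof.
have [->|/eqP ab] := eqVneq a b; first by move=> /seg_id -> /seg_id.
have [al [[_ ial] <- <- sE]] := dendrite_arc ab.
rewrite sE// => -[s /=]; rewrite in_itv/= => /andP[s0 s1] <-.
rewrite !sE// => -[u /=]; rewrite in_itv/= => /andP[u0 us] <-.
move=> [v /=]; rewrite in_itv/= => /andP[sv v1] /ial vu.
have uv : v = u by apply: vu; lra.
by congr al; lra.
Qed.

Lemma seg_anti a x y : seg a x y -> seg a y x -> x = y.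
Proof. by move=> axy ayx; exact: (seg_meet axy ayx). Qed.

Lemma seg_total a b x y : seg a b x -> seg a b y -> seg a x y \/ seg a y x.
Proof.
have [->|/eqP ab] := eqVneq a b; first by move=> /seg_id -> /seg_id ->; left.
have [al [_ <- <- sE]] := dendrite_arc ab.
rewrite sE// => -[s /=]; rewrite in_itv/= => /andP[s0 s1] <-.
move=> [t /=]; rewrite in_itv/= => /andP[t0 t1] <-.
have [st|/ltW ts] := leP s t; [right|left]; rewrite sE//.
  by exists s; rewrite //= in_itv/= s0.
by exists t; rewrite //= in_itv/= t0.
Qed.

Lemma seg_trans a b x y : seg a b x -> seg a x y -> seg a b y.
Proof. by move=> abx; apply: seg_incl. Qed.

Lemma seg_shift a b x y : seg a b x -> seg a x y -> seg y b x.
Proof.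
move=> abx axy; have [ayx|//] := @seg_cover a b y x abx.
by rewrite (seg_anti axy ayx).
Qed.

(** If [m] is off [seg b c], then [seg m c] and [seg c b] cut [seg m b] into two disjoint closed
    pieces. Connectedness leaves only the first, so [b] lies in [seg m c] and equals [m]. *)
Lemma seg_join b c m : (forall y, seg m b y -> seg m c y -> y = m) -> seg b c m.
Proof.
move=> h; apply: contrapT => nm.
have cov : seg m b `<=` seg m c `|` seg c b by exact: seg_cover.
have : seg m b `&` seg m c = seg m b.
  apply: (@seg_connected m b); first by exists m; split.
    exists (~` (seg c b)); first by apply: closed_openC; exact: seg_closed.
    apply/seteqP; split => y [mb my]; split => //.
      by move=> cb; apply: nm; rewrite segC -(h y mb my).
    by have [] := cov _ mb.
  by exists (seg m c) => //; exact: seg_closed.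
move=> E; have mb : (seg m b `&` seg m c) b by rewrite E; exact: seg_r.
by apply: nm; rewrite -(h b (@seg_r _ _ _) mb.2).
Qed.

Lemma seg_first (S : set X) a b y : closed S -> S y -> seg a b y ->
  exists m, [/\ S m, seg a y m & forall z, seg a m z -> S z -> z = m].
Proof.
move=> cS Sy aby.
have [ay|/eqP ay] := eqVneq a y.
  by subst y; exists a; split => // z /seg_id.
have [al [[cal ial] al0 al1 sE]] := dendrite_arc ay.
have [||l [Kl /andP[l0 l1] lP]] := @closed_first _ (al @^-1` S) 0 1 _ _ ler01.
- by apply: closed_comp => // t _; exact: cal.
- by rewrite /= al1.
exists (al l); split => //.
  rewrite -[a]al0 -[y]al1 sE//; by exists l; rewrite //= in_itv/= l0.
move=> z; rewrite -[a]al0 sE// => -[t /=]; rewrite in_itv/= => /andP[t0 tl] <- St.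
by move: tl; rewrite le_eqVlt => /predU1P[->//|/lP]; case/(_ t0).
Qed.

(** The median is the first point of [seg a c] on the way from [b] to [a]. *)
Lemma median a b c : exists m, [/\ seg a b m, seg b c m & seg a c m].
Proof.
have [m [Sm bm mP]] := @seg_first (seg a c) b a a (@seg_closed _ _) (@seg_l _ a c) (@seg_r _ b a).
exists m; split => //; first by rewrite segC.
apply: seg_join => y mb mc; apply: mP; first by rewrite segC.
exact: seg_incl Sm (@seg_r _ a c) _ mc.
Qed.

Lemma nbhs_connected x (U : set X) : nbhs x U ->
  exists V : set X, [/\ open V, connected V, V x & V `<=` U].
Proof. by have [_ lX _] := dX; exact: lX. Qed.

Lemma nbhs_separate x y : x <> y -> exists U V : set X,
  [/\ nbhs x U, nbhs y V & forall z, U z -> V z -> False].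
Proof.
move=> xy; have e0 : 0 < mdist x y / 2 by rewrite divr_gt0// mdist_gt0; apply/eqP.
exists [set z | mdist x z < mdist x y / 2], [set z | mdist y z < mdist x y / 2].
split; [by apply/nbhs_mdistE; exists (mdist x y / 2)|by apply/nbhs_mdistE; exists (mdist x y / 2)|].
move=> z /= xz yz; have := metric_triangle x z y; rewrite (metric_sym z y); lra.
Qed.

(** A small connected set containing [y] and [z] misses [x] when [y] differs from [x]; then [x] lies
    before both of [y] and [z] or before neither. *)
Lemma seg_up_closed a x : closed [set y | seg a y x].
Proof.
rewrite -[X in closed X]setCK; apply: open_closedC.
rewrite openE => y /= nx.
have xy : x <> y by move=> E; apply: nx; rewrite E; exact: seg_r.
have [U [V [nU nV UV]]] := nbhs_separate xy.
have [W [oW cW Wy WV]] := nbhs_connected nV.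
apply: (@filterS _ _ _ W); last exact: open_nbhs_nbhs.
move=> z Wz /= azx; have [//|yzx] := @seg_cover a z y x azx.
by apply: (UV x (nbhs_singleton nU)); apply: WV; exact: (seg_sub cW Wy Wz).
Qed.

Lemma seg_up_open a x y : seg a y x -> y <> x -> nbhs y [set z | seg a z x].
Proof.
move=> ayx yx; have [U [V [nU nV UV]]] := nbhs_separate yx.
have [W [oW cW Wy WU]] := nbhs_connected nU.
apply: (@filterS _ _ _ W); last exact: open_nbhs_nbhs.
move=> z Wz /=; have [//|zyx] := @seg_cover a y z x ayx.
exfalso; apply: (UV x); last exact: nbhs_singleton.
by apply: WU; exact: (seg_sub cW Wz Wy).
Qed.

(* Near a point moved by f, whether a point lies before its image can be tested
   against one fixed image. *)
Lemma moved_nbhs (f : X -> X) x : continuous f -> f x <> x -> exists N : set X,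
  [/\ open N, connected N, N x, ~ N (f x) & forall a y, N y ->
    f y <> y /\ (seg a (f x) y <-> seg a (f y) y)].
Proof.
move=> cf fx; have [U [V [nU nV UV]]] := nbhs_separate fx.
have [C [oC cC Cfx CU]] := nbhs_connected nU.
have nC : nbhs x (f @^-1` C) by apply: (cf x); exact: open_nbhs_nbhs.
have [N [oN cN Nx NV]] := nbhs_connected (filterI nV nC).
exists N; split => //; first by move=> /NV[Vf _]; exact: (UV _ (nbhs_singleton nU) Vf).
move=> a y /NV[Vy /= Cfy]; have nCy : ~ C y by move=> /CU Uy; exact: (UV y Uy Vy).
split; first by move=> E; apply: nCy; rewrite -E.
split => [h|h].
  by have [//|/(seg_sub cC Cfy Cfx)] := @seg_cover a (f x) (f y) y h.
by have [//|/(seg_sub cC Cfx Cfy)] := @seg_cover a (f y) (f x) y h.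
Qed.

Lemma before_image_closed (f : X -> X) a : continuous f -> closed [set x | seg a (f x) x].
Proof.
move=> cf; rewrite -[X in closed X]setCK; apply: open_closedC.
rewrite openE => x /= nx.
have fx : f x <> x by move=> E; apply: nx; rewrite E; exact: seg_r.
have [N [oN cN Nx nNf NP]] := moved_nbhs cf fx.
have : nbhs x (N `&` ~` (seg a (f x))).
  apply: filterI; first exact: open_nbhs_nbhs.
  by apply: open_nbhs_nbhs; split => //; apply: closed_openC; exact: seg_closed.
by apply: filterS => y [Ny nfy] /=; have [_ <-] := NP a y Ny.
Qed.

(** Otherwise [x] alone would be open and closed in the connected set [seg x b]. *)
Lemma seg_leave x b (N : set X) : open N -> connected N -> N x -> ~ N b ->
  exists y, [/\ seg x b y, y <> x, N y & seg x y `<=` N].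
Proof.
move=> oN cN Nx nNb.
have [y [xby yx Ny]] : exists y, [/\ seg x b y, y <> x & N y].
  apply: contrapT => h.
  have E : seg x b `&` N = [set x].
    apply/seteqP; split => [y [xby Ny]|_ ->]; last by split.
    by apply: contrapT => yx; apply: h; exists y.
  have : seg x b `&` N = seg x b.
    apply: (@seg_connected x b); first by exists x; split.
      by exists N.
    exists [set x]; first by apply: compact_closed; [exact: metric_hausdorff|exact: compact_set1].
    rewrite E; apply/seteqP; split => [_ ->|_ [_ ->]//].
    by split => //; exact: seg_l.
  rewrite E => /seteqP[_ /(_ b (@seg_r _ _ _)) /= bx].
  by apply: nNb; rewrite bx.
by exists y; split => //; exact: (seg_sub cN Nx Ny).
Qed.

Lemma convex_connected (S : set X) :
  (forall x y, S x -> S y -> seg x y `<=` S) -> connected S.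
Proof.
move=> cS; have [->|/set0P[p Sp]] := eqVneq S set0; first exact: connected0.
have -> : S = \bigcup_(x in S) seg p x.
  by apply/seteqP; split => [x Sx|y [x Sx]]; [exists x|exact: cS].
by apply: bigcup_connected; [exists p => x _ C|move=> x _; exact: seg_connected].
Qed.

End SegCalculus.

(** * Maximal points, fixed points and chains in a rooted tree *)

Section FiniteTree.
Context (R : realType) (X : metricType R).
Implicit Types a b c m x y z : X.

Section DendriteOrder.
Hypothesis dX : is_dendrite X.

(** Zorn's lemma: for a chain in [S], the closed sets of points of [S] beyond its members are
    nested, so they have a common point by compactness. *)
Lemma seg_maximal (S : set X) a x : closed S -> S x ->
  exists m, [/\ S m, seg a m x & forall y, S y -> seg a y m -> y = m].
Proof.
move=> cS Sx.
pose T := {y | S y /\ seg a y x}.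
pose le (u v : T) := `[< seg a (sval v) (sval u) >].
have lexx (u : T) : le u u by apply/asboolP; exact: seg_r.
have [|||[m [Sm mx]] mP] := @Zorn T le lexx.
- move=> u v w /asboolP uv /asboolP vw; apply/asboolP.
  exact: (seg_trans dX vw uv).
- move=> [u Pu] [v Pv] /asboolP/= uv /asboolP/= vu; apply: eq_exist.
  exact: (seg_anti dX vu uv).
- move=> A tA; have [[c Ac]|nA] := pselect (A !=set0); last first.
    by exists (exist _ x (conj Sx (@seg_r _ a x))) => s As; case: nA; exists s.
  have [[_ cX _] _ _] := dX.
  have /compact_near_coveringP cov := cX.
  apply: contrapT => nub.
  (* In the filter of tails of the chain, a covering by the complements of these closed sets would
     leave some member of the chain not beyond itself. *)
  pose G : set_system T := [set Q | exists2 u, A u & forall v, A v -> le u v -> Q v].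
  have FG : Filter G.
    split; first by exists c.
      move=> P Q [u Au uP] [v Av vQ].
      have [uv|vu] := tA u v Au Av; [exists v|exists u] => // w Aw sw; split.
      + by apply: uP => //; apply/asboolP; exact: (seg_trans dX (asboolW sw) (asboolW uv)).
      + exact: vQ.
      + exact: uP.
      + by apply: vQ => //; apply/asboolP; exact: (seg_trans dX (asboolW sw) (asboolW vu)).
    by move=> P Q PQ [u Au uP]; exists u => // v Av /(uP v Av)/PQ.
  have [] := cov T G (fun u z => ~ (S z /\ seg a z (sval u))) FG.
    move=> z _.
    have [u [Au nu]] : exists u, A u /\ ~ (S z /\ seg a z (sval u)).
      apply: contrapT => h; apply: nub.
      have hz u : A u -> S z /\ seg a z (sval u).
        by move=> Au; apply: contrapT => nu; apply: h; exists u.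
      have Pz : S z /\ seg a z x.
        have [Sz zc] := hz c Ac; split => //.
        exact: (seg_trans dX zc (svalP c).2).
      by exists (exist _ z Pz) => s As; apply/asboolP; have [] := hz s As.
    exists (~` (S `&` [set w | seg a w (sval u)]), [set v | le u v]).
      split => /=; last by exists u.
      apply: open_nbhs_nbhs; split => //; apply: closed_openC.
      by apply: closedI => //; exact: seg_up_closed.
    move=> [w v] [/= nw /asboolP uv] [Sw wv]; apply: nw; split => //.
    exact: (seg_trans dX wv uv).
  move=> u Au /(_ u Au (lexx u)) /(_ (sval u) I) []; split.
    by have [] := svalP u.
  exact: seg_r.
exists m; split => // y Sy ym.
have yx : seg a y x by exact: (seg_trans dX ym mx).
by have /(congr1 sval) := mP (exist _ y (conj Sy yx)) (asboolT ym).
Qed.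

(** Points close to [m] on the way from [m] to [f m] still lie before their images. So a moved point
    is never maximal among such points. *)
Lemma before_image_push (f : X -> X) a m : continuous f -> seg a (f m) m ->
  f m <> m -> exists y, [/\ y <> m, seg a y m & forall z, seg m y z -> seg a (f z) z].
Proof.
move=> cf am fm; have [N [oN cN Nm nNf NP]] := moved_nbhs dX cf fm.
have [y [my ym Ny myN]] := seg_leave dX oN cN Nm nNf.
exists y; split => //.
  by rewrite segC; apply: (seg_shift dX (b := a) (x := m) (a := f m)); rewrite segC.
move=> z myz; have [_ <-] := NP a z (myN z myz).
apply: (seg_incl dX am (@seg_r _ _ _)).
exact: (seg_trans dX my myz).
Qed.

Lemma before_image_fixed (f : X -> X) a x : continuous f -> seg a (f x) x ->
  exists2 w, f w = w & seg a w x.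
Proof.
move=> cf ax.
have [m [am mx mP]] := seg_maximal (S := [set x | seg a (f x) x]) a
  (before_image_closed dX cf) ax.
exists m => //; apply: contrapT => fm.
have [y [ym ay yP]] := before_image_push cf am fm.
by apply: ym; apply: mP => //; apply: yP; exact: seg_r.
Qed.

(** The argument is that of [before_image_fixed], with a maximal point among those whose whole
    segment from the root lies pointwise before its image. *)
Lemma before_image_seg_fixed (f : X -> X) a x : continuous f ->
  (forall y, seg a x y -> seg a (f y) y) ->
  exists w, [/\ f w = w, seg a w x & forall y, seg a w y -> seg a (f y) y].
Proof.
move=> cf ax; pose U := [set y | seg a (f y) y].
have cU : closed U by exact: before_image_closed.
have [||m [am mx mP]] := @seg_maximal [set x | forall y, seg a x y -> U y] a x.
- rewrite -[X in closed X]setCK; apply: open_closedC; rewrite openE => z /= nz.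
  have [y [zy nUy]] : exists y, seg a z y /\ ~ U y.
    apply: contrapT => h; apply: nz => y zy; apply: contrapT => nUy.
    by apply: h; exists y.
  have [E|/eqP yz] := eqVneq y z.
    subst y; have : nbhs z (~` U) by apply: open_nbhs_nbhs; split => //; exact: closed_openC.
    by apply: filterS => w nUw /= wU; apply: nUw; apply: wU; exact: seg_r.
  apply: filterS (seg_up_open dX zy (not_eq_sym yz)) => w /= wy wU.
  by apply: nUy; exact: wU.
- exact: ax.
exists m; split => //; apply: contrapT => fm.
have [y [ym ay yP]] := before_image_push cf (am m (@seg_r _ _ _)) fm.
apply: ym; apply: mP => // z yz.
by have [/am//|] := @seg_cover _ _ dX a y m z yz; exact: yP.
Qed.

(** Any two of [x], [y], [z] are separated by [m], so they lie in three distinct components of its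
    complement. *)
Lemma median_branching m x y z : m <> x -> m <> y -> m <> z ->
  seg x y m -> seg y z m -> seg x z m -> is_branching_point m.
Proof.
move=> mx my mz xy yz xz.
pose cc := connected_component (~` [set m]).
have ne u v : m <> u -> m <> v -> seg u v m -> cc u <> cc v.
  move=> mu mv uv E.
  have nmu : (~` [set m]) u by move=> /= /esym.
  have nmv : (~` [set m]) v by move=> /= /esym.
  have : cc u m.
    apply: uv; first exact: component_connected.
      exact: connected_component_refl.
    by rewrite E; exact: connected_component_refl.
  by move/connected_component_sub; apply.
pose g (i : nat) := if i is 0%N then cc x else if i is 1%N then cc y else cc z.
have gi : set_inj `I_3 g.
  have h1 := ne _ _ mx my xy; have h2 := ne _ _ my mz yz; have h3 := ne _ _ mx mz xz.
  by move=> [|[|[|i]]] [|[|[|j]]]; rewrite !in_setE //= => _ _ E; exfalso; move: E; first [exact: h1|exact: h2|exact: h3|exact/nesym].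
rewrite /is_branching_point -(card_le_eql (inj_card_eq gi)).
apply: subset_card_le => _ [[|[|i]] _ <-] /=.
- by exists x => // /esym.
- by exists y => // /esym.
- by exists z => // /esym.
Qed.

End DendriteOrder.

Hypothesis tX : is_finite_tree X.

(* Cutting at the branching points makes the order of the tree rooted at a a
   union of finitely many chains, indexed by the last branching point b before x
   and the component of the complement of b that contains x. *)
Lemma finitely_many_chains a : exists M (key : X -> nat), (forall x, (key x < M)%N) /\
  forall x y, key x = key y -> seg a y x \/ seg a x y.
Proof.
have [dX fB fC] := tX.
pose B := [set x | is_branching_point x] `|` [set a].
have finB : finite_set B by rewrite finite_setU; split => //; exact: finite_set1.
have closed_fin (S : set X) : finite_set S -> closed S.
  by move=> /finite_compact; apply: compact_closed; exact: metric_hausdorff.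
have /choice[b bP] : forall x, exists b, x <> a -> [/\ B b, b <> x, seg a x b &
    forall z, seg x b z -> B z -> z <> x -> z = b].
  move=> x; have [->|/eqP xa] := eqVneq x a; first by exists a.
  have finS : finite_set (B `\` [set x]) by exact: finite_setD.
  have aS : (B `\` [set x]) a by split; [right|exact: not_eq_sym].
  have [b [[Bb bx] xb bP]] := seg_first dX (closed_fin _ finS) aS (@seg_r _ x a).
  exists b => _; split => //; first by rewrite segC.
  by move=> z xz Bz zx; apply: bP => //; split.
pose cmp x := connected_component (~` [set b x]) x.
pose F := \bigcup_(c in B) ((fun C => (c, C)) @` complement_components c).
have finF : finite_set F.
  apply: bigcup_finite => // c Bc; apply: finite_image.
  have [bc|nbc] := pselect (is_branching_point c); first exact: fC.
  (* Infinitely many components would include three, and [c] would be a branching point. *)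
  apply: contrapT => /infiniteP inf; apply: nbc.
  exact: card_le_trans (subset_card_le (@subsetT _ _)) inf.
have /finite_seqP[s sE] := finF.
have inF x : x <> a -> (b x, cmp x) \in s.
  move=> xa; have : F (b x, cmp x).
    have [Bb bx _ _] := bP x xa.
    exists (b x) => //; exists (cmp x) => //; exists x => //.
    by move=> /= /esym.
  by rewrite sE.
(* The root may receive the index [size s], hence the successor. *)
exists (size s).+1, (fun x => index (b x, cmp x) s); split.
  by move=> x; rewrite ltnS index_size.
move=> x y E.
have [->|/eqP xa] := eqVneq x a; first by left; exact: seg_l.
have [->|/eqP ya] := eqVneq y a; first by right; exact: seg_l.
have := congr1 (nth (b x, cmp x) s) E; rewrite !nth_index ?inF// => -[Eb Ec].
(* The median is where the ways from [a] to [x] and [y] part. If it is neither [x] nor [y], it is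
   the common cut point [b x = b y], yet [x] and [y] lie in one component of its complement. *)
have [m [xm mxy my]] := median dX a x y.
have [mx|/eqP mx] := eqVneq m x; first by left; rewrite -mx.
have [my'|/eqP my'] := eqVneq m y; first by right; rewrite -my'.
have Bm : B m.
  have [ma|/eqP ma] := eqVneq m a; first by right.
  by left; apply: (median_branching ma mx my').
have [Bb bx axb xP] := bP x xa; have [_ by_ ayb yP] := bP y ya.
have mb : m = b x.
  rewrite segC in axb; rewrite segC in ayb.
  have xm' : seg x a m by rewrite segC.
  have ym' : seg y a m by rewrite segC.
  have [h|h] := seg_total dX axb xm'; first exact: xP.
  have [k|k] := seg_total dX ayb ym'; first by rewrite Eb; exact: yP.
  apply/esym; apply: (seg_meet dX mxy h); rewrite segC Eb.
  exact: k.
have nb : ~ (cmp x m) by rewrite mb => /connected_component_sub; apply.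
case: nb; apply: mxy.
- exact: component_connected.
- by apply: connected_component_refl => /= /esym.
- rewrite Ec; apply: connected_component_refl => /= /esym; exact: by_.
Qed.

End FiniteTree.

(** * Dynamics *)

Section Iterates.
Context (R : realType) (X : metricType R) (f : X -> X).
Hypothesis cf : continuous f.
Implicit Types (x y z : X) (A : set X).

Lemma iter_continuous n : continuous (iter n f).
Proof.
elim: n => [|n IHn] x; first exact: cvg_id.
by apply: (@continuous_comp _ _ _ (iter n f) f); [exact: IHn|exact: cf].
Qed.

Lemma iter_mulE m n x : iter m (iter n f) x = iter (m * n) f x.
Proof. by elim: m => [//|m IHm]; rewrite iterS IHm mulSn iterD. Qed.

Lemma iter_fix n k x : iter n f x = x -> iter (k * n) f x = x.
Proof. by move=> nx; rewrite -iter_mulE; elim: k => [//|k /= ->]. Qed.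

(** Both points return to themselves after [k * (m * n)] steps, and these pass through step [k]. *)
Lemma iter_per_inj k m n x y : (0 < m)%N -> iter m f x = x -> (0 < n)%N -> iter n f y = y ->
  iter k f x = iter k f y -> x = y.
Proof.
move=> m0 mx n0 ny kxy.
have kmn : (k <= k * (m * n))%N by rewrite leq_pmulr// muln_gt0 m0.
have -> : x = iter (k * (m * n)) f x.
  by rewrite (mulnC m) mulnA iter_fix.
have -> : y = iter (k * (m * n)) f y by rewrite mulnA iter_fix.
by rewrite -(subnK kmn) !iterD kxy.
Qed.

Lemma fix_iter_core n x : (0 < n)%N -> iter n f x = x -> image_core f x.
Proof.
move=> n0 nx m /= m0; have mn : (m <= m * n)%N by rewrite leq_pmulr.
by exists (iter (m * n - m) f x) => //; rewrite -iterD subnKC// iter_fix.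
Qed.

Lemma Per_core : Per f `<=` image_core f.
Proof. by move=> x [n /= n0 nx]; exact: fix_iter_core nx. Qed.

Lemma image_core_sub A n : (0 < n)%N -> A `<=` iter n f @` A -> A `<=` image_core f.
Proof.
move=> n0 An x Ax m /= m0.
have [z Az zE] : exists2 z, A z & iter (m * n) f z = x.
  elim: m x Ax {m0} => [|m IHm] x Ax; first by exists x.
  have [y Ay <-] := An x Ax; have [z Az <-] := IHm y Ay.
  by exists z => //; rewrite mulSn iterD.
have mn : (m <= m * n)%N by rewrite leq_pmulr.
by exists (iter (m * n - m) f z) => //; rewrite -iterD subnKC.
Qed.

Lemma image_core_fwd n x : image_core f x -> image_core f (iter n f x).
Proof.
by move=> cx m /= m0; have [y _ <-] := cx m m0; exists (iter n f y); rewrite // -!iterD addnC.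
Qed.

Lemma backward_orbit (T : Type) (g : T -> T) (S : set T) (x : T) :
  S `<=` g @` S -> S x ->
  exists u : nat -> T, [/\ u 0%N = x, forall j, S (u j) & forall j, g (u j.+1) = u j].
Proof.
move=> Sg Sx.
have /choice[h hP] : forall y : T, exists z : T, S y -> S z /\ g z = y.
  move=> y; have [/Sg [z Sz zy]|nS] := pselect (S y); first by exists z.
  by exists y.
have Sh j : S (iter j h x) by elim: j => [//|j IHj]; have [] := hP _ IHj.
exists (fun j => iter j h x); split => // j.
by rewrite iterS; have [] := hP _ (Sh j).
Qed.

Lemma backward_iter (T : Type) (g : T -> T) (u : nat -> T) i j :
  (forall j, g (u j.+1) = u j) -> iter i g (u (i + j)%N) = u j.
Proof.
by move=> gu; elim: i j => [//|i IHi] j; rewrite iterSr addSn gu IHi.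
Qed.

(** If [y], the image of [x], has period [k], the preimage of [x] reached in [A] after [k.-1]
    backward steps has the same image as [y] under [k] steps. Both are periodic, so they coincide
    and [y] is in [A]. *)
Lemma periodic_core_not_expanding : Per f = image_core f ->
  ~ (exists A : set X, is_expanding_arc f A).
Proof.
move=> PE [A [_ [n [n0 [An nA]]]]]; apply: nA => _ [x Ax <-].
have Acore := image_core_sub n0 An.
have per z : image_core f z -> exists2 k, (0 < k)%N & iter k f z = z.
  by rewrite -PE => -[k k0 kz]; exists k.
set y := iter n f x.
have [k k0 ky] : exists2 k, (0 < k)%N & iter k f y = y.
  by apply: per; apply: image_core_fwd; exact: Acore.
have [u [u0 uA uS]] := backward_orbit An Ax.
have [l l0 lu] := per _ (Acore _ (uA k.-1)).
suff <- : u k.-1 = y by exact: uA.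
apply: (@iter_per_inj (k * n) l k) => //.
have -> : iter (k * n) f y = y by rewrite mulnC iter_fix.
rewrite -iter_mulE -[k in LHS](prednK k0) iterS.
by have := backward_iter (k.-1) 0 uS; rewrite addn0 => ->; rewrite u0.
Qed.

Hypothesis cX : compact [set: X].

Lemma arc_closed A : is_arc A -> closed A.
Proof.
move=> [h [k [ch ck hk kh]]]; apply: compact_closed; first exact: metric_hausdorff.
have -> : A = range (set_val \o h).
  apply/seteqP; split => [x Ax|_ [t _ <-]]; last exact: set_valP.
  by exists (k (exist _ x (mem_set Ax))) => //=; rewrite kh.
apply: continuous_compact.
  apply: continuous_subspaceT => t; apply: continuous_comp; first exact: ch.
  exact: initial_continuous.
by apply: compact_set_type; exact: segment_compact.
Qed.

Lemma sequence_cluster (u : nat -> X) : exists z, forall (e : R) n, 0 < e ->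
  exists2 m, (n <= m)%N & mdist z (u m) < e.
Proof.
have [z [_ clz]] := @cX (u m @[m --> \oo]) _ filterT.
exists z => e n e0.
have [||_ [[m /= nm <-] zm]] := clz [set u m | m in [set m | (n <= m)%N]]
   [set w | mdist z w < e].
- by exists n => // m /= nm; exists m.
- by apply/nbhs_mdistE; exists e.
by exists m.
Qed.

(** Two terms [u i] and [u j], with [i < j], of a backward orbit in [A] are close to a cluster point
    [z]. After [i.+1] steps of the power they become [y] and a point of [A]; hence [y] is
    arbitrarily close to the closed set [A]. *)
Lemma equicontinuous_not_expanding : is_equicontinuous f ->
  ~ (exists A : set X, is_expanding_arc f A).
Proof.
move=> ef [A [arcA [n [n0 [An nA]]]]]; apply: nA => _ [x Ax <-].
have cA := arc_closed arcA.
have [u [u0 uA uS]] := backward_orbit An Ax.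
have [z zP] := sequence_cluster u.
set y := iter n f x; apply: contrapT => nAy.
have [e e0 eP] := (open_mdist _).1 (closed_openC cA) y nAy.
have e20 : 0 < e / 4 by rewrite divr_gt0.
have [d d0 dP] := ef z _ e20.
have [i _ zi] := zP d 0%N d0.
have [j ij zj] := zP d i.+1 d0.
have N0 : (0 < i.+1 * n)%N by rewrite muln_gt0.
have := dP _ zi _ N0; have := dP _ zj _ N0.
have -> : iter (i.+1 * n) f (u i) = y.
  rewrite -iter_mulE iterS; have := backward_iter i 0 uS.
  by rewrite addn0 => ->; rewrite u0.
have -> : iter (i.+1 * n) f (u j) = u (j - i.+1)%N.
  by rewrite -iter_mulE -(backward_iter i.+1 (j - i.+1) uS) subnKC.
set w := iter _ f z => h1 h2.
apply: (eP (u (j - i.+1)%N)); last exact: uA.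
have := metric_triangle y w (u (j - i.+1)%N).
by rewrite (metric_sym y w); lra.
Qed.

(** The ranges of the iterates are decreasing compact sets whose intersection is the core. *)
Lemma image_core_nbhs (W : set X) : open W -> image_core f `<=` W ->
  exists m, forall k x, (m <= k)%N -> W (iter k f x).
Proof.
move=> oW coreW; have /compact_near_coveringP cov := cX.
have := cov nat \oo (fun k x => range (iter k f) x -> W x) _.
case=> [x _|m _ mP]; last first.
  by exists m => k x mk; apply: (mP k mk (iter k f x) I); exists x.
have [Wx|nWx] := pselect (W x).
  exists (W, setT) => [|[y k] [/= Wy _] _ //]; split; last exact: filterT.
  exact: open_nbhs_nbhs.
have /existsNP[m /not_implyP[/= m0 nm]] : ~ image_core f x by move=> /coreW.
have cr : closed (range (iter m f)).
  apply: compact_closed; first exact: metric_hausdorff.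
  by apply: continuous_compact => //; apply: continuous_subspaceT; exact: iter_continuous.
exists (~` range (iter m f), [set k | (m <= k)%N]).
  split; last by exists m.
  by apply: open_nbhs_nbhs; split => //; exact: closed_openC.
move=> [y k] [/= ny mk] [z _ zy]; case: ny; exists (iter (k - m) f z) => //.
by rewrite -iterD subnKC.
Qed.

(** If no core point were sent to [y], the open set of points not sent to [y] would contain the
    range of some iterate, while [y] is in the range of the next one. *)
Lemma image_core_surj y : image_core f y -> exists2 x, image_core f x & f x = y.
Proof.
move=> cy; apply: contrapT => nx.
have [||m mP] := @image_core_nbhs [set x | f x <> y].
- rewrite (_ : [set x | f x <> y] = f @^-1` (~` [set y]))//.
  by apply: open_comp => [x _|]; [exact: cf|exact: open_setC1].
- by move=> x cx /= fx; apply: nx; exists x.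
have [x _ xy] := cy m.+1 isT; exact: (mP m x (leqnn _)).
Qed.

Lemma image_core_iter_surj n y : image_core f y -> exists2 x, image_core f x & iter n f x = y.
Proof.
elim: n y => [|n IHn] y cy; first by exists y.
have [z cz <-] := image_core_surj cy; have [x cx <-] := IHn z cz.
by exists x.
Qed.

End Iterates.

(** * Nonprincipal ultrafilters and equicontinuity *)

Section Ultrafilters.
Context (R : realType) (X : metricType R) (f : X -> X).
Hypothesis cX : compact [set: X].
Implicit Types (x y z : X) (u : set_system posnat).

Lemma equicontinuous_ultra_iter u : is_equicontinuous f -> UltraFilter u ->
  continuous (ultra_iter u f).
Proof.
move=> ef uU x; apply/metricType_numDomainType.cvgrPdist_le => e e0.
have e30 : 0 < e / 3 by rewrite divr_gt0.
have [d d0 dP] := ef x _ e30.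
apply/nbhs_mdistE; exists d => // y /dP xy.
have uF : ProperFilter u by exact: ultra_proper.
have hx := ultra_iterP f x cX uU e30.
have hy := ultra_iterP f y cX uU e30.
have [[n n0] [/= xn yn]] := filter_ex (filterI hx hy).
have := xy n n0.
have := metric_triangle (ultra_iter u f x) (iter n f x) (ultra_iter u f y).
have := metric_triangle (iter n f x) (iter n f y) (ultra_iter u f y).
rewrite (metric_sym (iter n f y)); lra.
Qed.

Lemma exists_nonprincipal_ultrafilter : exists u, is_nonprincipal_ultrafilter u.
Proof.
pose s (n : nat) : posnat := exist _ n.+1 isT.
have [u [uU uP]] := ultraFilterLemma (fmap_proper_filter s (@eventually_filter)).
exists u; split => // n un.
have : u [set m | (val n < val m)%N].
  by apply: uP; exists (val n) => // m /= nm; rewrite ltnS.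
by rewrite un => /principal_filterP /=; rewrite ltnn.
Qed.

Lemma nonprincipal_tail u n : is_nonprincipal_ultrafilter u ->
  u [set m : posnat | (n < val m)%N].
Proof.
move=> [uU unp].
have uF : ProperFilter u by exact: ultra_proper.
have single (k : posnat) : u (~` [set k]).
  have [uk|//] := in_ultra_setVsetC [set k] uU.
  exfalso; apply: (unp k); apply/seteqP; split => [A uA|A Ak].
    by have [_ [-> Ak]] := filter_ex (filterI uk uA); exact/principal_filterP.
  by apply: (filterS _ uk) => _ ->; exact/principal_filterP.
elim: n => [|n IHn]; first by apply: filterS filterT => -[m m0] _.
apply: (filterS _ (filterI IHn (single (exist _ n.+1 isT)))) => -[m m0] [/= nm mn].
rewrite ltn_neqAle nm andbT; apply/eqP => E; apply: mn.
exact: val_inj.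
Qed.

End Ultrafilters.

Lemma pigeonhole_nat (M : nat) (k : nat -> nat) : (forall i, (k i < M)%N) ->
  exists i j, [/\ (i < j)%N, (j <= M)%N & k i = k j].
Proof.
move=> kM; pose h (i : 'I_M.+1) : 'I_M := Ordinal (kM i).
have /injectivePn[i [j ij hij]] : ~~ injectiveb h.
  by apply/injectiveP => /leq_card; rewrite !card_ord ltnn.
have kij : k i = k j by have /(congr1 val) := hij.
have : (i != j :> nat) by [].
rewrite neq_ltn => /orP[ltij|ltji]; [exists i, j|exists j, i];
  by split => //; rewrite -ltnS.
Qed.

(** * Expanding arcs, connectedness of periodic points and periodicity of the core *)

Section TreeDynamics.
Context (R : realType) (X : metricType R) (f : X -> X).
Hypothesis tX : is_finite_tree X.
Hypothesis cf : continuous f.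
Implicit Types (p q x y z : X) (S : set X).

Let dX : is_dendrite X. Proof. by have [] := tX. Qed.
Let cX : compact [set: X]. Proof. by have [[_ ? _] _ _] := dX. Qed.
Let kX : connected [set: X]. Proof. by have [[_ _ ?] _ _] := dX. Qed.

Lemma image_connected (g : X -> X) S : continuous g -> connected S -> connected (g @` S).
Proof.
by move=> cg cS; apply: connected_continuous_connected => //; exact: continuous_subspaceT.
Qed.

Lemma seg_image (g : X -> X) x y : continuous g -> seg (g x) (g y) `<=` g @` seg x y.
Proof.
move=> cg; apply: seg_sub; last 2 first.
- by exists x => //; exact: seg_l.
- by exists y => //; exact: seg_r.
by apply: image_connected => //; exact: seg_connected.
Qed.

Lemma image_core_convex x y : image_core f x -> image_core f y ->
  seg x y `<=` image_core f.
Proof.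
move=> cx cy z xyz m m0; apply: xyz; [|exact: cx|exact: cy].
by apply: image_connected => //; exact: iter_continuous.
Qed.

Lemma image_core_closed : closed (image_core f).
Proof.
apply: closed_bigI => m _; apply: compact_closed; first exact: metric_hausdorff.
by apply: continuous_compact => //; apply: continuous_subspaceT; exact: iter_continuous.
Qed.

Lemma Per_common p q : Per f p -> Per f q ->
  exists n, [/\ (0 < n)%N, iter n f p = p & iter n f q = q].
Proof.
move=> [m /= m0 mp] [n /= n0 nq]; exists (m * n)%N; split.
- by rewrite muln_gt0 m0.
- by rewrite mulnC iter_fix.
- by rewrite iter_fix.
Qed.

Lemma not_expanding_Per_connected :
  ~ (exists A : set X, is_expanding_arc f A) -> connected (Per f).
Proof.
move=> nexp; apply: (convex_connected dX) => p q Pp Pq y pqy.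
have [n [n0 np nq]] := Per_common Pp Pq.
exists n => //=; pose g := iter n f; change (g y = y).
have cg : continuous g by exact: iter_continuous.
(* Seen from a fixed point [a], a moved point lying before its image makes [seg a x] expand. *)
have expand a x : g a = a -> seg a (g x) x -> g x = x.
  move=> ga ax; apply: contrapT => gx; apply: nexp; exists (seg a x); split.
    by apply: seg_is_arc => // ax'; apply: gx; rewrite -ax'.
  exists n; split => //; split.
    move=> z axz; rewrite -/g; apply: (seg_image cg); rewrite ga.
    exact: (seg_trans dX ax axz).
  move=> h; apply: gx; apply: (seg_anti dX ax).
  by apply: h; exists x => //; exact: seg_r.
(* If [g y] stays on the segment, [y] lies before it as seen from [p] or from [q]; otherwise
   [seg p q] itself expands. *)
have [gy|ngy] := pselect (seg p q (g y)).
  have [h|h] := seg_total dX pqy gy; last exact: (expand p).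
  apply: (expand q) => //.
  by rewrite segC; rewrite segC in gy; apply: (seg_shift dX (b := q) pqy h).
exfalso; apply: nexp; exists (seg p q); split.
  apply: seg_is_arc => // pq; apply: ngy; rewrite -pq in pqy *.
  by rewrite (seg_id pqy) [g p]np; exact: seg_l.
exists n; split => //; split.
  by move=> z pqz; apply: (seg_image cg); rewrite [g p]np [g q]nq.
by move=> h; apply: ngy; apply: h; exists y.
Qed.

Lemma Fix_connected_Per_connected :
  (forall n, (0 < n)%N -> connected (Fix (iter n f))) -> connected (Per f).
Proof.
move=> cF; apply: (convex_connected dX) => p q Pp Pq y pqy.
have [n [n0 np nq]] := Per_common Pp Pq.
by exists n => //; exact: (seg_sub (cF n n0) np nq).
Qed.

Section OrderPreserving.
Variables (g : X -> X) (S : set X).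
Hypothesis cg : continuous g.
Hypothesis convS : forall x y, S x -> S y -> seg x y `<=` S.
Hypothesis injS : forall x y, S x -> S y -> g x = g y -> x = y.

(** By injectivity the images of [seg p y] and [seg y x] meet only at [g y], which is what
    [seg_join] asks for. *)
Lemma injective_seg p x y : S p -> S x -> seg p x y -> seg (g p) (g x) (g y).
Proof.
move=> Sp Sx pxy; have Sy := convS Sp Sx pxy.
apply: (seg_join dX) => z /(seg_image cg)[z1 yz1 <-] /(seg_image cg)[z2 yz2 E].
have Sz1 := convS Sy Sp yz1; have Sz2 := convS Sy Sx yz2.
rewrite (injS Sz2 Sz1 E) in yz2.
by rewrite segC in yz1; rewrite (seg_meet dX pxy yz1 yz2).
Qed.

(** Since [g] preserves the order, the orbit of [y] is monotone, and a periodic monotone orbit is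
    constant. *)
Lemma periodic_comparable_fixed p y k : (forall x, S x -> S (g x)) -> S p -> S y ->
  g p = p -> (0 < k)%N -> iter k g y = y ->
  seg p (g y) y \/ seg p y (g y) -> g y = y.
Proof.
move=> gS Sp Sy gp k0 ky.
have Si j : S (iter j g y) by elim: j => [//|j /gS].
case=> h.
  have step j : seg p (iter j.+1 g y) (iter j g y).
    elim: j => [//|j IHj]; rewrite -gp !iterS.
    by apply: injective_seg => //; exact: (Si j.+1).
  have : seg p (iter k g y) (g y).
    rewrite -(prednK k0); elim: (k.-1) => [|j IHj]; first exact: seg_r.
    exact: (seg_trans dX (step j.+1) IHj).
  by rewrite ky => h'; apply: (seg_anti dX h h').
have step j : seg p (iter j g y) (iter j.+1 g y).
  elim: j => [//|j IHj]; rewrite -gp !iterS.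
    by apply: injective_seg => //; exact: (Si j).
have : seg p (g y) (iter k g y).
  rewrite -(prednK k0); elim: (k.-1) => [|j IHj]; first exact: seg_r.
  exact: (seg_trans dX IHj (step j.+1)).
by rewrite ky => h'; apply: (seg_anti dX h' h).
Qed.

End OrderPreserving.

(** A point between two fixed points of [iter m f] is periodic, and its image lies on the same
    segment, so that the two are comparable. *)
Lemma periodic_core_Fix_connected n m : (0 < n)%N ->
  (forall x, image_core f x -> iter n f x = x) -> (0 < m)%N ->
  connected (Fix (iter m f)).
Proof.
move=> n0 nid m0; apply: (convex_connected dX) => x y mx my z xyz.
have coreE w : iter m f w = w -> image_core f w by exact: fix_iter_core.
have cz : image_core f z by apply: image_core_convex xyz; exact: coreE.
have inj a b : image_core f a -> image_core f b -> iter m f a = iter m f b -> a = b.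
  by move=> /nid na /nid nb; exact: iter_per_inj na _ nb.
have conv := image_core_convex.
have xz : seg x y (iter m f z).
  have := injective_seg (iter_continuous cf (n := m)) conv inj (coreE x mx) (coreE y my) xyz.
  by rewrite mx my.
apply: (@periodic_comparable_fixed (iter m f) (image_core f) (iter_continuous cf (n := m)) conv inj x z n) => //.
- by move=> w; exact: image_core_fwd.
- exact: coreE.
- by rewrite iter_mulE mulnC iter_fix// nid.
- by case: (seg_total dX xz xyz); [left|right].
Qed.

Lemma exists_fixed_point : exists p, f p = p.
Proof.
have [[[a _] _ _] _ _] := dX.
by have [p fp _] := before_image_fixed dX cf (@seg_l _ a (f a)); exists p.
Qed.

(** Among the first [M.+1] points of an orbit two lie in one chain, so a power at most [M] fixes one
    of them, and then [x] by injectivity. The factorial of [M] is a common multiple of all these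
    powers. *)
Lemma Per_connected_bounded_period : connected (Per f) ->
  exists N, (0 < N)%N /\ Per f `<=` Fix (iter N f).
Proof.
move=> cP; have [p fp] := exists_fixed_point.
have [M [key [keyM keyP]]] := finitely_many_chains tX p.
exists M`!; split; first exact: fact_gt0.
move=> x Px; have [l /= l0 lx] := Px.
have [i [j [ij jM kij]]] := pigeonhole_nat (fun i => keyM (iter i f x)).
pose m := (j - i)%N; pose y := iter i f x.
have m0 : (0 < m)%N by rewrite subn_gt0.
have Pfwd k z : Per f z -> Per f (iter k f z).
  by move=> [r r0 rz]; exists r; rewrite /Fix /= -?iterD 1?addnC ?iterD ?rz.
have my : iter m f y = y.
  apply: (@periodic_comparable_fixed (iter m f) (Per f) _ _ _ p y l).
  - exact: iter_continuous.
  - by move=> a b Pa Pb; exact: (seg_sub cP Pa Pb).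
  - by move=> a b [r r0 ra] [s s0 sb]; exact: (iter_per_inj r0 ra s0 sb).
  - by move=> z; exact: Pfwd.
  - by exists 1%N.
  - exact: Pfwd.
  - by have := @iter_fix _ _ f 1 m p fp; rewrite muln1.
  - exact: l0.
  - by rewrite iter_mulE mulnC iter_fix// /y -iterD addnC iterD lx.
  - have -> : iter m f y = iter j f x by rewrite /y -iterD subnK// ltnW.
    exact: keyP.
have mx : iter m f x = x.
  have lmx : iter l f (iter m f x) = iter m f x by rewrite -iterD addnC iterD lx.
  apply: (iter_per_inj (k := i) l0 lmx l0 lx).
  by rewrite -iterD addnC iterD.
have /dvdnP[r ->] : (m %| M`!)%N.
  by rewrite dvdn_fact// m0 (leq_trans (leq_subr _ _)).
exact: iter_fix.
Qed.

Lemma Per_connected_periodic_core : connected (Per f) ->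
  exists n, (0 < n)%N /\ (forall x, image_core f x -> iter n f x = x).
Proof.
move=> cP; have [N [N0 PN]] := Per_connected_bounded_period cP.
exists N; split => // y0 cy0.
pose g := iter N f; have cg : continuous g by exact: iter_continuous.
have [p fp] := exists_fixed_point.
have Pp : Per f p by exists 1%N.
have gp : g p = p by exact: PN.
have [M [key [keyM keyP]]] := finitely_many_chains tX p.
suff Py0 : Per f y0 by exact: PN.
apply: contrapT => nPy0.
have belowP x y : Per f x -> seg p x y -> Per f y.
  by move=> Px; exact: (seg_sub cP Pp Px).
pose D := [set e | [/\ image_core f e, ~ Per f e &
  forall y, image_core f y -> seg p y e -> y = e]].
have up y : image_core f y -> ~ Per f y -> exists2 e, D e & seg p e y.
  move=> cy nPy; have [e [ce ey emax]] := seg_maximal dX p image_core_closed cy.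
  by exists e => //; split => // Pe; apply: nPy; exact: belowP ey.
(* A core preimage of a nonperiodic point is nonperiodic, hence lies before some maximal point in
   [D]. *)
have Dg : D `<=` [set e | exists2 e', D e' & exists2 z, seg p e' z & g z = e].
  move=> e [ce nPe _]; have [z cz gz] := image_core_iter_surj cf cX N ce.
  have [|e' De' e'z] := up z cz; last by exists e' => //; exists z.
  by move=> Pz; apply: nPe; rewrite -gz [iter N f z]PN.
have /choice[h hP] : forall e, exists e', D e -> D e' /\ exists2 z, seg p e' z & g z = e.
  move=> e; have [/Dg [e' De' e'z]|nD] := pselect (D e); first by exists e'.
  by exists e.
have [e0 De0 _] := up y0 cy0 nPy0.
pose e j := iter j h e0.
have De j : D (e j) by elim: j => [//|j IHj]; have [Dh _] := hP _ IHj; exact: Dh.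
have seg_step j : seg p (e j) `<=` g @` seg p (e j.+1).
  have [_ [z ez gz]] := hP _ (De j).
  move=> w; rewrite -gz -{1}gp => /(seg_image cg)[v pzv <-].
  by exists v => //; exact: (seg_trans dX ez pzv).
have seg_iter i k : seg p (e i) `<=` iter k g @` seg p (e (k + i)%N).
  elim: k => [|k IHk] w; first by exists w.
  move=> /IHk[v /seg_step[u eu <-] <-]; exists u => //.
  by rewrite -iterSr.
have [i [j [ij jM kij]]] := pigeonhole_nat (fun i => keyM (e i)).
have [ci nPi maxi] := De i; have [cj nPj maxj] := De j.
(* Two maximal points in the same chain coincide. *)
have eij : e i = e j.
  have [h1|h1] := keyP _ _ kij; last exact: maxj.
  by apply/esym; exact: maxi.
(* The point [z] lies before [e i], which is its image under a power of [g]. A periodic point beyond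
   [z] makes [z], and then [e i], periodic. *)
have [z ez zE] := seg_iter i (j - i)%N (e i) (@seg_r _ _ _).
rewrite subnK ?(ltnW ij)// -eij in ez.
have [w wfix wz] : exists2 w, iter (j - i) g w = w & seg p w z.
  apply: (before_image_fixed dX); first by exact: iter_continuous.
  by rewrite zE.
have Pw : Per f w.
  exists ((j - i) * N)%N; first by rewrite /= muln_gt0 subn_gt0 ij.
  by rewrite /Fix /= -iter_mulE.
apply: nPi; have [r r0 rz] := belowP _ _ Pw wz.
by exists r; rewrite // /Fix /= -zE iter_mulE -iterD addnC iterD rz.
Qed.

End TreeDynamics.

(** * From a periodic core to equicontinuity *)

Section PeriodicCore.
Context (R : realType) (X : metricType R) (f : X -> X).
Hypothesis cf : continuous f.
Implicit Types (p q x y z : X).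

Lemma equicontinuous_upto x K (e : R) : 0 < e -> exists2 d : R, 0 < d &
  forall y, mdist x y < d -> forall k, (k < K)%N -> mdist (iter k f x) (iter k f y) < e.
Proof.
move=> e0; elim: K => [|K [d d0 dP]]; first by exists 1.
have /metricType_numDomainType.cvgrPdist_lt/(_ e e0) :
  iter K f y @[y --> x] --> iter K f x by exact: iter_continuous.
move=> /nbhs_mdistE[d' d'0 d'P].
exists (Num.min d d'); first by rewrite lt_min d0.
move=> y; rewrite lt_min => /andP[/dP yd /d'P yd'] k; rewrite ltnS leq_eqVlt.
by move=> /predU1P[->//|]; exact: yd.
Qed.

Hypothesis tX : is_finite_tree X.

Let dX : is_dendrite X. Proof. by have [] := tX. Qed.
Let cX : compact [set: X]. Proof. by have [[_ ? _] _ _] := dX. Qed.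

Section Gates.
Variables (Y : set X) (p : X) (r : X -> X).
Hypothesis convY : forall x y, Y x -> Y y -> seg x y `<=` Y.
Hypothesis Yp : Y p.
Hypothesis rP : forall x, [/\ Y (r x), seg x p (r x) &
  forall z, seg x (r x) z -> Y z -> z = r x].

(** The segment from [r x] to [y] stays in [Y], so it meets the segment from [x] to [r x] only at
    [r x]. *)
Lemma gate x y : Y y -> seg x y (r x).
Proof.
move=> Yy; have [Yr xr rx] := rP x.
apply: (seg_join dX) => z z1 z2; apply: rx; first by rewrite segC.
exact: convY z2.
Qed.

(** Two points outside [Y] in one chain share their gate, since the way from the farther one to its
    gate passes through the nearer one. *)
Lemma gates_finite : finite_set (r @` ~` Y).
Proof.
have [M [key [keyM keyP]]] := finitely_many_chains tX p.
have half x y : ~ Y x -> seg p y x -> r x = r y.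
  move=> nYx yx; have [Yr yr ry] := rP y.
  have yrx : seg y (r y) x.
    rewrite segC in yx; have [//|h] := @seg_cover _ _ dX y p (r y) x yx.
    by case: nYx; exact: convY h.
  apply: ry; last by have [] := rP x.
  exact: (seg_incl dX yrx (@seg_r _ _ _) (gate Yr)).
have same x y : ~ Y x -> ~ Y y -> key x = key y -> r x = r y.
  by move=> nYx nYy /keyP[h|h]; [exact: half h|apply/esym; exact: half h].
have /choice[c cP] : forall k : nat, exists x, (exists2 x', ~ Y x' & key x' = k) -> ~ Y x /\ key x = k.
  move=> k; have [[x nYx xk]|nk] := pselect (exists2 x', ~ Y x' & key x' = k).
    by exists x.
  by exists p.
apply: (@sub_finite_set _ _ ((r \o c) @` `I_M)); last by apply: finite_image; exact: finite_II.
move=> _ [x nYx <-]; exists (key x); first exact: keyM.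
have [|nYc kc] := cP (key x); first by exists x.
exact: same.
Qed.

End Gates.

Lemma finite_set_isolated (B : set X) b : finite_set B ->
  exists2 d : R, 0 < d & forall b', B b' -> b' <> b -> d <= mdist b b'.
Proof.
move=> fB; have cS : closed (B `\` [set b]).
  apply: compact_closed; first exact: metric_hausdorff.
  by apply: finite_compact; exact: finite_setD.
have [|d d0 dP] := (open_mdist _).1 (closed_openC cS) b; first by move=> [_]; apply.
exists d => // b' Bb' b'b; rewrite leNgt; apply/negP => /dP; apply.
by split.
Qed.

Section Stabilization.
Variables (g : X -> X) (Y : set X) (p : X).
Hypothesis cg : continuous g.
Hypothesis closedY : closed Y.
Hypothesis convY : forall x y, Y x -> Y y -> seg x y `<=` Y.
Hypothesis Yp : Y p.
Hypothesis gY : forall y, Y y -> g y = y.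
Hypothesis attract : forall W : set X, open W -> Y `<=` W ->
  exists m, forall k x, (m <= k)%N -> W (iter k g x).

(* An orbit close to Y but outside of it stays near a single gate, since gates
   are fixed and finitely many. *)
Lemma iter_uniformly_cauchy (e : R) : 0 < e -> exists m, forall x j,
  mdist (iter m g x) (iter (j + m) g x) < e.
Proof.
move=> e0; have e20 : 0 < e / 2 by rewrite divr_gt0.
have /choice[r rP] : forall x, exists r, [/\ Y r, seg x p r &
    forall z, seg x r z -> Y z -> z = r].
  by move=> x; have [m [Ym xm mP]] := seg_first dX closedY Yp (@seg_r _ x p); exists m.
pose B := r @` ~` Y.
have fB : finite_set B by exact: (gates_finite convY Yp rP).
have BY : B `<=` Y by move=> _ [x _ <-]; have [] := rP x.
have /choice[rho rhoP] : forall b, exists d : R, 0 < d /\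
    forall b', B b' -> b' <> b -> d <= mdist b b'.
  by move=> b; have [d d0 dP] := finite_set_isolated b fB; exists d.
(* The second bound makes the balls [W b] around distinct gates disjoint; the first keeps two points
   of one ball less than [e] apart. *)
pose rad b := Num.min (e / 2) (rho b / 2).
have rad0 b : 0 < rad b by rewrite lt_min e20 divr_gt0//; have [] := rhoP b.
pose W b := [set y | mdist b y < rad b].
have Wdisj b b' y : B b -> B b' -> W b y -> W b' y -> b = b'.
  move=> Bb Bb'; rewrite /W/= /rad !lt_min => /andP[_ h] /andP[_ h'].
  apply: contrapT => bb'; have [_ /(_ b' Bb' (nesym bb')) h1] := rhoP b.
  have [_ /(_ b Bb bb') h2] := rhoP b'; have := metric_triangle b y b'.
  by rewrite (metric_sym y b'); rewrite (metric_sym b' b) in h2; lra.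
pose V b := W b `&` g @^-1` W b.
have nV b : B b -> nbhs b (V b).
  move=> Bb; have nW : nbhs b (W b) by apply/nbhs_mdistE; exists (rad b).
  have nWg : nbhs (g b) (W b) by rewrite gY//; exact: BY.
  have ng : nbhs b (g @^-1` W b) := @cg b _ nWg.
  exact: (filterI nW ng).
pose O := Y `|` \bigcup_(b in B) V b.
(* Around a point of [Y] that is not a gate, a small connected set without gates lies inside [Y], as
   leaving [Y] passes through a gate. *)
have YO : Y `<=` O^°.
  move=> y Yy; have [By|nBy] := pselect (B y).
    by apply: filterS (nV y By) => z Vz; right; exists y.
  have nB : nbhs y (~` B).
    apply: open_nbhs_nbhs; split => //; apply: closed_openC.
    apply: compact_closed; first exact: metric_hausdorff.
    exact: finite_compact.
  have [N [oN cN Ny NB]] := nbhs_connected dX nB.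
  apply: (@filterS _ _ _ N); last exact: open_nbhs_nbhs.
  move=> x Nx; left; apply: contrapT => nYx.
  apply: (NB (r x)); last by exists x.
  exact: (seg_sub cN Nx Ny (gate convY rP (x := x) Yy)).
have [m mP] := attract (@open_interior _ O) YO.
have inO k x : (m <= k)%N -> O (iter k g x).
  by move=> mk; apply: interior_subset; exact: mP.
exists m => x j.
have [Ym|nYm] := pselect (Y (iter m g x)).
  have -> : iter (j + m) g x = iter m g x by rewrite iterD; elim: j => [//|j /= ->]; exact: gY.
  by rewrite mdistxx.
have [//|[b Bb Vb]] := inO m x (leqnn _).
(* From [V b] the next point is in [W b]. It is either in [Y], and then stays put, or in some
   [V b'], where [b' = b] by disjointness. *)
have : W b (iter (j + m) g x) /\ (Y (iter (j + m) g x) \/ V b (iter (j + m) g x)).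
  elim: j => [|j [Wj [Yj|Vj]]]; first by split; [case: Vb|right].
    by rewrite addSn iterS gY//; split => //; left.
  have Wj1 : W b (iter (j.+1 + m) g x) by case: Vj.
  split => //; have [Yj|[b' Bb' Vb']] := inO (j.+1 + m)%N x (leq_addl _ _); first by left.
  by right; rewrite (Wdisj b b' _ Bb Bb' Wj1 Vb'.1).
move=> [Wj _]; have [Wm _] := Vb.
move: Wj Wm; rewrite /W /= /rad !lt_min => /andP[h1 _] /andP[h2 _].
have := metric_triangle (iter m g x) b (iter (j + m) g x).
by rewrite (metric_sym _ b); lra.
Qed.

End Stabilization.

(** For [N] at least [m.+1 * n], iterate [N] is within [eps / 3] of iterate [m * n + N %% n] at
    every point. So only finitely many iterates remain, and these are handled by continuity. *)
Lemma periodic_core_equicontinuous n : (0 < n)%N ->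
  (forall x, image_core f x -> iter n f x = x) -> is_equicontinuous f.
Proof.
move=> n0 nid x eps eps0.
have e0 : 0 < eps / 3 by rewrite divr_gt0.
have [p fp] := exists_fixed_point tX cf.
have Yp : image_core f p by exact: (@fix_iter_core _ _ f 1).
have [|m mP] := @iter_uniformly_cauchy (iter n f) (image_core f) p (iter_continuous cf (n := n))
  (image_core_closed tX cf) (image_core_convex tX cf) Yp nid _ _ e0.
  move=> W oW YW; have [m mP] := image_core_nbhs cf cX oW YW.
  by exists m => k y mk; rewrite iter_mulE; apply: mP; rewrite (leq_trans mk)// leq_pmulr.
have [d d0 dP] := equicontinuous_upto x (m.+1 * n) e0.
exists d => // y /dP xy N _.
have [Nn|nN] := ltnP N (m.+1 * n); first by apply: ltW; apply: (lt_le_trans (xy N Nn)); lra.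
have mq : (m <= N %/ n)%N by rewrite leq_divRL// (leq_trans _ nN)// leq_mul2r leqnSn orbT.
have NE z : iter N f z = iter (N %/ n - m + m) (iter n f) (iter (N %% n) f z).
  by rewrite subnK// iter_mulE -iterD -divn_eq.
have mE z : iter m (iter n f) (iter (N %% n) f z) = iter (m * n + N %% n) f z.
  by rewrite iter_mulE iterD.
have hk : (m * n + N %% n < m.+1 * n)%N by rewrite mulSn addnC ltn_add2r ltn_mod.
have := xy _ hk; rewrite -!mE !NE.
have := mP (iter (N %% n) f x) (N %/ n - m)%N.
have := mP (iter (N %% n) f y) (N %/ n - m)%N.
set a := iter m _ (iter _ f x); set b := iter m _ (iter _ f y).
set a' := iter (_ + _) _ (iter _ f x); set b' := iter (_ + _) _ (iter _ f y).
move=> h1 h2 h3; have := metric_triangle a' a b'; have := metric_triangle a b b'.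
by rewrite (metric_sym a' a); lra.
Qed.

End PeriodicCore.

(** * Ultrafilter limits at periodic and attracted points *)

Section UltrafilterLimits.
Context (R : realType) (X : metricType R) (f : X -> X).
Hypothesis cf : continuous f.
Hypothesis cX : compact [set: X].
Variable u : set_system posnat.
Hypothesis np : is_nonprincipal_ultrafilter u.
Implicit Types (p q x y z : X).

Let uU : UltraFilter u. Proof. by case: np. Qed.
#[local] Instance uF : ProperFilter u. Proof. exact: ultra_proper. Qed.
Let F := ultra_iter u f.

Definition attracted (g : X -> X) q x := forall e : R, 0 < e ->
  exists J, forall j, (J <= j)%N -> mdist q (iter j g x) < e.

(** Dividing the time [n] by [N], iterate [n] of [x] is one of finitely many continuous maps,
    indexed by the remainder, applied to a point close to [q]. *)
Lemma ultra_iter_attracted N q x : (0 < N)%N -> iter N f q = q ->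
  attracted (iter N f) q x -> F x = F q.
Proof.
move=> N0 Nq xq; apply: eq_mdist_le => e e0.
have e30 : 0 < e / 3 by rewrite divr_gt0.
have [d d0 dP] := equicontinuous_upto cf q N e30.
have [J JP] := xq d d0.
have hx := ultra_iterP f x cX uU e30.
have hq := ultra_iterP f q cX uU e30.
have ht := nonprincipal_tail (J * N) np.
have [[n n0] hn] := filter_ex (filterI (filterI hx hq) ht).
have [h12 Jn] := hn; have [h1 h2] := h12; rewrite /= in h1 h2 Jn.
have := dP _ (JP (n %/ N)%N _) (n %% N)%N _.
rewrite leq_divRL// ltn_mod => /(_ (ltnW Jn) N0).
have -> : iter (n %% N) f q = iter n f q.
  by rewrite [in RHS](divn_eq n N) addnC iterD iter_fix.
have -> : iter (n %% N) f (iter (n %/ N) (iter N f) x) = iter n f x.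
  by rewrite iter_mulE -iterD addnC -divn_eq.
move: h1 h2; rewrite -/F => h1 h2 h3.
have := metric_triangle (F x) (iter n f x) (F q).
have := metric_triangle (iter n f x) (iter n f q) (F q).
by rewrite (metric_sym (iter n f x) (iter n f q)) (metric_sym (iter n f q) (F q)); lra.
Qed.

(** The orbits of distinct periodic points stay a positive distance apart at equal times, as only
    [N] pairs occur. *)
Lemma ultra_iter_periodic_inj N p q : (0 < N)%N -> iter N f p = p -> iter N f q = q ->
  F p = F q -> p = q.
Proof.
move=> N0 Np Nq Fpq; apply: contrapT => pq.
have sep K : exists2 r : R, 0 < r & forall k, (k < K)%N -> r <= mdist (iter k f p) (iter k f q).
  elim: K => [|K [r r0 rP]]; first by exists 1.
  exists (Num.min r (mdist (iter K f p) (iter K f q))).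
    rewrite lt_min r0 mdist_gt0; apply/eqP => E; apply: pq.
    exact: (iter_per_inj N0 Np N0 Nq E).
  move=> k; rewrite ltnS leq_eqVlt ge_min => /predU1P[->|/rP ->//].
  by rewrite lexx orbT.
have [r r0 rP] := sep N.
have r20 : 0 < r / 2 by rewrite divr_gt0.
have hp := ultra_iterP f p cX uU r20.
have hq := ultra_iterP f q cX uU r20.
have [[n n0] [/= h1 h2]] := filter_ex (filterI hp hq).
have := rP (n %% N)%N; rewrite ltn_mod => /(_ N0).
have E z : iter N f z = z -> iter (n %% N) f z = iter n f z.
  by move=> Nz; rewrite [in RHS](divn_eq n N) addnC iterD iter_fix.
rewrite !E//; move: h1 h2; rewrite -/F => h1 h2.
rewrite -Fpq in h2; have := metric_triangle (iter n f p) (F p) (iter n f q).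
by rewrite (metric_sym (iter n f p) (F p)); real_lra R.
Qed.

Lemma ultra_iter_unstable N p q : continuous F -> (0 < N)%N ->
  iter N f p = p -> iter N f q = q ->
  (forall e : R, 0 < e -> exists2 x, mdist p x < e & attracted (iter N f) q x) ->
  p = q.
Proof.
move=> cF N0 Np Nq h; apply: (ultra_iter_periodic_inj N0 Np Nq).
apply: eq_mdist_le => e e0.
have /metricType_numDomainType.cvgrPdist_lt/(_ e e0) : F y @[y --> p] --> F p by exact: cF.
move=> /nbhs_mdistE[d d0 dP]; have [x px xq] := h d d0.
by have := dP x px; rewrite (ultra_iter_attracted N0 Nq xq) => /ltW.
Qed.

End UltrafilterLimits.

(** * Monotone sequences and repelling ends of a segment *)

Section MonotoneSequences.
Context (R : realType) (X : metricType R).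
Hypothesis dX : is_dendrite X.
Implicit Types (p q x y z : X).

Let cX : compact [set: X]. Proof. by have [[_ ? _] _ _] := dX. Qed.

(** The sequence moves toward [a], and a cluster point [z] lies before all its terms. Once a term is
    in a small connected neighbourhood of [z], so are the later ones, which lie between it and
    [z]. *)
Lemma seg_sequence_cvg a (v : nat -> X) : (forall j, seg a (v j) (v j.+1)) ->
  exists z, (forall j, seg a (v j) z) /\
    forall e : R, 0 < e -> exists J, forall j, (J <= j)%N -> mdist z (v j) < e.
Proof.
move=> vS; have vle i j : (i <= j)%N -> seg a (v i) (v j).
  move=> /subnK <-; elim: (j - i)%N => [|k IHk]; first exact: seg_r.
  exact: (seg_trans dX IHk (vS _)).
have [z zP] := sequence_cluster cX v.
have vz j : seg a (v j) z.
  apply: contrapT => nz.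
  have [e e0 eP] := (open_mdist _).1 (closed_openC (seg_closed dX (a := a) (b := v j))) z nz.
  have [m jm /eP] := zP e j e0; apply; exact: vle.
exists z; split => // e e0.
have nz : nbhs z [set y | mdist z y < e] by apply/nbhs_mdistE; exists e.
have [W [oW cW Wz We]] := nbhs_connected dX nz.
have [d d0 dP] := (open_mdist W).1 oW z Wz.
have [J _ /dP WJ] := zP d 0%N d0.
exists J => j Jj; apply: We; apply: (seg_sub cW Wz WJ).
exact: (seg_shift dX (vle _ _ Jj) (vz j)).
Qed.

Lemma cvg_fixed (g : X -> X) (v w : nat -> X) z : continuous g ->
  (forall e : R, 0 < e -> exists J, forall j, (J <= j)%N -> mdist z (v j) < e) ->
  (forall e : R, 0 < e -> exists J, forall j, (J <= j)%N -> mdist z (w j) < e) ->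
  (forall j, g (v j) = w j) -> g z = z.
Proof.
move=> cg vz wz gv; apply: eq_mdist_le => e e0.
have e20 : 0 < e / 2 by rewrite divr_gt0.
have /metricType_numDomainType.cvgrPdist_lt/(_ _ e20) : g y @[y --> z] --> g z by exact: cg.
move=> /nbhs_mdistE[d d0 dP].
have [J1 h1] := vz d d0; have [J2 h2] := wz _ e20.
have := dP _ (h1 (maxn J1 J2) (leq_maxl _ _)); rewrite gv.
have := h2 (maxn J1 J2) (leq_maxr _ _).
have := metric_triangle (g z) (w (maxn J1 J2)) z.
by rewrite (metric_sym (w _) z); lra.
Qed.

(** Each [y] on [seg p x0] lies on [seg p (g y)], so it has a preimage on [seg p y]. Iterated
    preimages of [x0] move toward [p] and converge to a fixed point, which can only be [p]. *)
Lemma backward_orbit_fixed (g : X -> X) p x0 : continuous g -> g p = p ->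
  (forall y, seg p x0 y -> seg p (g y) y) ->
  (forall y, seg p x0 y -> g y = y -> y = p) ->
  forall e : R, 0 < e -> exists x j, mdist p x < e /\ iter j g x = x0.
Proof.
move=> cg gp up fixp e e0.
have /choice[h hP] : forall y, exists z, seg p x0 y -> seg p y z /\ g z = y.
  move=> y; have [/up yP|ny] := pselect (seg p x0 y); last by exists y.
  rewrite -{1}gp in yP.
  have : (g @` seg p y) y.
    apply: (yP (g @` seg p y)).
    - apply: connected_continuous_connected; first exact: seg_connected.
      exact: continuous_subspaceT.
    - by exists p => //; exact: seg_l.
    - by exists y => //; exact: seg_r.
  by move=> [z pyz gz]; exists z.
pose v j := iter j h x0.
have v0 j : seg p x0 (v j).
  elim: j => [|j IHj]; first exact: seg_r.
  by have [pv _] := hP _ IHj; exact: (seg_trans dX IHj pv).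
have vS j : seg p (v j) (v j.+1) by have [] := hP _ (v0 j).
have gv j : g (v j.+1) = v j by have [] := hP _ (v0 j).
have [z [vz zP]] := seg_sequence_cvg vS.
have gz : g z = z.
  apply: (cvg_fixed (v := fun j => v j.+1) (w := v) cg _ zP gv).
  by move=> d /zP[J JP]; exists J => j Jj; apply: JP; exact: leqW.
have zp : z = p by apply: fixp => //; exact: (vz 0%N).
have [J JP] := zP e e0.
exists (v J), J; split; first by rewrite -zp; exact: JP.
by have := backward_iter J 0 gv; rewrite addn0 => ->.
Qed.

(** Let [m] be the first point of [V] from [y2] to [y1]. The points before it are in the closed set
    [U], so [m] is in both, and it is not fixed. By [moved_nbhs], points just before [m] then also
    lie before their images as seen from [q], against the choice of [m]. *)
Lemma no_crossing (g : X -> X) p q y1 y2 : continuous g -> g p = p -> g q = q ->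
  (forall y, seg p q y -> g y = y -> y = p \/ y = q) ->
  seg p q y1 -> seg p q y2 -> seg p y2 y1 ->
  ~ seg p (g y1) y1 -> ~ seg q (g y2) y2 -> False.
Proof.
move=> cg gp gq fixpq pqy1 pqy2 y21 nU1 nV2.
pose U := [set y | seg p (g y) y]; pose V := [set y | seg q (g y) y].
have UV y : seg p q y -> U y \/ V y.
  by move=> pqy; have [|] := @seg_cover _ _ dX p q (g y) y pqy; [left|right; rewrite /V /= segC].
have cU : closed U by exact: before_image_closed.
have cV : closed V by exact: before_image_closed.
have Vy1 : V y1 by have [] := UV y1 pqy1.
have [m [Vm y12m mP]] := seg_first dX cV Vy1 (@seg_r _ y2 y1).
have my2 : m <> y2 by move=> E; apply: nV2; rewrite -E.
have inpq z : seg y2 m z -> seg p q z.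
  move=> h; have h1 := seg_trans dX y12m h.
  exact: (seg_incl dX pqy2 pqy1 h1).
have pqm : seg p q m by apply: inpq; exact: seg_r.
have p2m : seg p y2 m by exact: (seg_incl dX (@seg_r _ p y2) y21 y12m).
have near_m (N : set X) : open N -> connected N -> N m ->
    exists z, [/\ N z, seg m y2 z & z <> m].
  move=> oN cN Nm; have [N2|nN2] := pselect (N y2).
    by exists y2; split => //; exact/nesym.
  have [z [mz zm Nz zN]] := seg_leave dX oN cN Nm nN2.
  by exists z.
have Um : U m.
  apply: contrapT => nUm.
  have nU : nbhs m (~` U) by apply: open_nbhs_nbhs; split => //; exact: closed_openC.
  have [N [oN cN Nm NU]] := nbhs_connected dX nU.
  have [z [Nz mz zm]] := near_m N oN cN Nm.
  rewrite segC in mz; have [|Vz] := UV z (inpq z mz); first exact: NU.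
  by apply: zm; exact: mP.
have gm : g m <> m.
  move=> /(fixpq m pqm)[] E.
    apply: nU1; suff -> : y1 = p by rewrite gp; exact: seg_l.
    rewrite E in y12m; rewrite segC in y21.
    exact: (seg_anti dX y12m y21).
  apply: nV2; suff -> : y2 = q by rewrite gq; exact: seg_l.
  by rewrite E in p2m; exact: (seg_anti dX p2m pqy2).
have [N [oN cN Nm _ NP]] := moved_nbhs dX cg gm.
have [z [Nz mz zm]] := near_m N oN cN Nm.
apply: zm; apply: mP; first by rewrite segC.
have [_ [h _]] := NP q z Nz; apply: h.
apply: (seg_trans dX Vm).
have mqy2 : seg q m y2 by rewrite segC; exact: (seg_shift dX pqy2 p2m).
exact: (seg_incl dX (@seg_r _ q m) mqy2 mz).
Qed.

(** If every point of the segment lies before its image as seen from [q], any inner point serves as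
    [c]; otherwise [no_crossing] makes [p] repelling up to an exceptional point [v]. *)
Lemma exists_repelled_seg (g : X -> X) p q z : continuous g -> g p = p -> g q = q ->
  (forall y, seg p q y -> g y = y -> y = p \/ y = q) ->
  seg p q z -> z <> p -> z <> q ->
  exists c, [/\ seg p q c, c <> p, c <> q &
    (forall y, seg p c y -> seg p (g y) y) \/ (forall y, seg q c y -> seg q (g y) y)].
Proof.
move=> cg gp gq fixpq pqz zp zq.
have [[v [pqv nVv]]|nv] := pselect (exists v, seg p q v /\ ~ seg q (g v) v).
  exists v; split => //.
  - by move=> E; apply: nVv; rewrite E gp; exact: seg_r.
  - by move=> E; apply: nVv; rewrite E; exact: seg_l.
  left => y pvy; apply: contrapT => nUy.
  exact: (no_crossing cg gp gq fixpq (seg_trans dX pqv pvy) pqv pvy nUy nVv).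
exists z; split => //; right => y qzy; apply: contrapT => nVy; apply: nv; exists y; split => //.
exact: (seg_incl dX (@seg_r _ p q) pqz qzy).
Qed.

End MonotoneSequences.

(** * Continuity of an ultrafilter limit forces periodic points to be connected *)

Section UltrafilterContinuity.
Context (R : realType) (X : metricType R) (f : X -> X).
Hypothesis tX : is_finite_tree X.
Hypothesis cf : continuous f.
Implicit Types (p q x y z : X).

Let dX : is_dendrite X. Proof. by have [] := tX. Qed.
Let cX : compact [set: X]. Proof. by have [[_ ? _] _ _] := dX. Qed.
Let lX : is_locally_connected X. Proof. by have [] := dX. Qed.

Lemma Fix_closed (g : X -> X) : continuous g -> closed (Fix g).
Proof.
move=> cg; rewrite -[X in closed X]setCK; apply: open_closedC; rewrite openE => x gx.
have [M [oM _ Mx _ MP]] := moved_nbhs dX cg gx.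
apply: (@filterS _ _ _ M); last exact: open_nbhs_nbhs.
by move=> y My; have [] := MP x y My.
Qed.

(* Close to q, the side of q containing p is a free arc, since branching points
   are finite in number. *)
Lemma free_arc p q c : p <> q -> c <> q -> seg p q c ->
  exists c1 (N : set X), [/\ seg c q c1, c1 <> q, nbhs q N, ~ N c1 &
    forall x, N x -> ~ seg p x q -> seg c1 q x].
Proof.
move=> pq cq pqc; have [_ fB _] := tX.
pose S := ([set x : X | is_branching_point x] `|` [set c]) `\` [set q].
have cS : closed S.
  apply: compact_closed; first exact: metric_hausdorff.
  apply: finite_compact; apply: finite_setD.
  by rewrite finite_setU; split; [exact: fB|exact: finite_set1].
have Sc : S c by split; [right|].
have [c1 [[_ c1q] qc1 c1P]] := seg_first dX cS Sc (@seg_r _ q c).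
have nq : (~` [set c1]) q by move=> /= /esym.
exists c1, (connected_component (~` [set c1]) q); split => //.
- by rewrite segC.
- apply: open_nbhs_nbhs; split; last exact: connected_component_refl.
  by apply: open_connected_component => //; exact: open_setC1.
- by move/connected_component_sub; apply.
(* A median different from [x] would be a branching point strictly between [q] and [c1], against the
   choice of [c1]. *)
move=> x Nx npx; have [m [m1 m2 m3]] := median dX c1 q x.
have c1pq : seg p q c1 by apply: (seg_incl dX pqc (@seg_r _ p q)); rewrite segC.
have mc1 : m <> c1.
  move=> E; rewrite E in m2.
  suff : connected_component (~` [set c1]) q c1 by move/connected_component_sub; apply.
  apply: m2 => //; first exact: component_connected.
  exact: connected_component_refl.
have mq : m <> q.
  move=> E; rewrite E in m3; apply: npx.
  have [h|//] := @seg_cover _ _ dX c1 x p q m3.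
  by case: c1q; apply: (seg_anti dX (a := p)) => //; rewrite segC.
have [<-|/eqP mx] := eqVneq m x; first exact: m1.
exfalso; apply: (mc1); apply: c1P; first by rewrite segC.
by split => //; left; apply: (median_branching mc1 mq mx).
Unshelve. all: by [].
Qed.

Section Repelling.
Variables (u : set_system posnat) (N : nat) (p c : X).
Hypothesis np : is_nonprincipal_ultrafilter u.
Hypothesis cF : continuous (ultra_iter u f).
Hypothesis N0 : (0 < N)%N.
Hypothesis gp : iter N f p = p.
Hypothesis cp : c <> p.
Hypothesis up : forall y, seg p c y -> seg p (iter N f y) y.
Hypothesis fixp : forall y, seg p c y -> iter N f y = y -> y = p.

Let g := iter N f.
Let cg : continuous g. Proof. exact: iter_continuous. Qed.

(* Some fixed point q beyond c attracts points of the segment from p to q whose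
   backward orbits converge to p. *)
Lemma no_repelling_fixed_point : False.
Proof.
have [w [gw wc wU]] := before_image_seg_fixed dX cg up.
have cFix : closed (Fix g) by exact: Fix_closed.
have [q [gq cwq qP]] := seg_first dX cFix (gw : Fix g w) (@seg_r _ c w).
have gc : g c <> c by move=> /(fixp (@seg_r _ p c)).
have cq : c <> q by move=> E; apply: gc; rewrite E.
have qpc : seg p q c.
  rewrite segC; apply: (seg_shift dX (a := w)); first by rewrite segC.
  by rewrite segC.
have pq : p <> q by move=> E; apply: cp; rewrite -E in qpc; exact: seg_id.
have pwq : seg p w q by exact: (seg_incl dX wc (@seg_r _ p w) cwq).
have qU y : seg p q y -> seg p (g y) y by move=> h; apply: wU; exact: (seg_trans dX pwq h).
have fixq y : seg p q y -> g y = y -> y = p \/ y = q.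
  move=> /(@seg_cover _ _ dX p q c y)[h|h] gy; first by left; exact: fixp.
  by right; exact: qP.
have below x : seg p q x -> x <> q -> ~ seg p x q.
  by move=> h xq h'; apply: xq; exact: (seg_anti dX h' h).
have back x : seg p q x -> x <> q -> forall e : R, 0 < e ->
    exists x' j, mdist p x' < e /\ iter j g x' = x.
  move=> pqx xq; apply: (backward_orbit_fixed dX cg gp).
    by move=> y pxy; apply: qU; exact: (seg_trans dX pqx pxy).
  move=> y pxy gy; have [//|E] := fixq y (seg_trans dX pqx pxy) gy.
  by case: (below x pqx xq); rewrite -E.
(* Points arbitrarily close to [p] reach [x], so they would be attracted by [q] as well, which
   [ultra_iter_unstable] excludes. *)
have not_attracted x : seg p q x -> x <> q -> ~ attracted g q x.
  move=> pqx xq xatt; apply: pq.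
  apply: (ultra_iter_unstable cf cX np cF N0 gp gq) => e e0.
  have [x' [j [px' jx']]] := back x pqx xq e e0.
  exists x' => // d d0; have [J JP] := xatt d d0.
  exists (J + j)%N => k Jk; rewrite -(subnK (leq_trans (leq_addl _ _) Jk)) iterD jx'.
  by apply: JP; rewrite leq_subRL ?(leq_trans (leq_addl _ _) Jk)// addnC.
have gnq x : seg p q x -> x <> q -> g x <> q.
  move=> pqx xq gxq; apply: (not_attracted x pqx xq) => e e0.
  exists 1%N => -[//|j] _; rewrite iterSr gxq.
  have -> : iter j g q = q by elim: j => [//|j /= ->].
  by rewrite mdistxx.
(* If [g x] were beyond [q], some point of [seg p x] would be mapped to [q]. *)
have side x : seg p q x -> x <> q -> ~ seg p (g x) q.
  move=> pqx xq; rewrite -{1}gp => /(seg_image tX cg)[y pxy].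
  apply: gnq; first exact: (seg_trans dX pqx pxy).
  by move=> E; apply: (below x pqx xq); rewrite -E.
have [c1 [M [cqc1 c1q nM nMc1 MP]]] := free_arc pq cq qpc.
have pqc1 : seg p q c1 by exact: (seg_incl dX qpc (@seg_r _ p q) cqc1).
have nqM : nbhs q (M `&` g @^-1` M).
  apply: filterI => //; apply: (cg (x := q)).
  by rewrite gq.
have [V [oV cV Vq VM]] := nbhs_connected dX nqM.
have nVc1 : ~ V c1 by move=> /VM[].
have [y0 [qy0 y0q Vy0 yV]] := seg_leave dX oV cV Vq nVc1.
have in_seg y : seg q y0 y -> seg p q y.
  move=> h; apply: (seg_incl dX (@seg_r _ p q) pqc1).
  exact: (seg_trans dX qy0 h).
(* Near [q] the image is on the free arc by [side], and it is farther from [p] than [y]; hence it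
   lies between [y] and [q]. *)
have toward y : seg q y0 y -> seg q y (g y).
  move=> h; have pqy := in_seg y h.
  have [E|/eqP yq] := eqVneq y q; first by rewrite E gq; exact: seg_r.
  have [_ Mgy] := VM _ (yV y h).
  have c1qgy := MP _ Mgy (side y pqy yq).
  have pqgy : seg p q (g y) by exact: (seg_incl dX pqc1 (@seg_r _ p q) c1qgy).
  by rewrite segC; exact: (seg_shift dX pqgy (qU y pqy)).
pose v j := iter j g y0.
have v0 j : seg q y0 (v j).
  elim: j => [|j IHj]; first exact: seg_r.
  exact: (seg_trans dX IHj (toward _ IHj)).
have vS j : seg q (v j) (v j.+1) by exact: toward.
have [z [vz zP]] := seg_sequence_cvg dX vS.
have gz : g z = z.
  apply: (cvg_fixed (v := v) (w := fun j => v j.+1) cg zP) => //.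
  by move=> d /zP[J JP]; exists J => j Jj; apply: JP; exact: leqW.
(* The limit cannot be [p], because it lies on the far side of [c]. *)
have zq : z = q.
  have [E|//] := fixq z (in_seg z (vz 0%N)) gz.
  exfalso; apply: cp.
  have qcc1 : seg q c c1 by rewrite segC.
  have qcp : seg q c p by rewrite -E; exact: (seg_trans dX qcc1 (seg_trans dX qy0 (vz 0%N))).
  by apply: (seg_anti dX qcp); rewrite segC.
by apply: (not_attracted y0 (in_seg _ (@seg_r _ _ _)) y0q); rewrite -zq.
Qed.

End Repelling.

Lemma ultra_iter_continuous_Per_connected (u : set_system posnat) :
  is_nonprincipal_ultrafilter u -> continuous (ultra_iter u f) -> connected (Per f).
Proof.
move=> np cF; apply: (convex_connected dX) => p' q' Pp' Pq' z pqz.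
have [N [N0 Np' Nq']] := Per_common Pp' Pq'.
exists N => //; apply: contrapT => gz.
pose g := iter N f; have cg : continuous g by exact: iter_continuous.
have cFix : closed (Fix g) by exact: Fix_closed.
(* [p'] and [q'] are replaced by the fixed points nearest to the moved point [z] on either side. *)
have [p [gp zp pP]] := seg_first dX cFix (Np' : Fix g p') (@seg_r _ z p').
have [q [gq zq qP]] := seg_first dX cFix (Nq' : Fix g q') (@seg_r _ z q').
have pz : z <> p by move=> E; apply: gz; rewrite E.
have qz : z <> q by move=> E; apply: gz; rewrite E.
have pqz1 : seg p q z.
  have h : seg p q' z by apply: (seg_shift dX pqz); rewrite segC.
  rewrite (segC p q') in h; rewrite (segC p q).
  by apply: (seg_shift dX h); rewrite segC.
have fixpq y : seg p q y -> g y = y -> y = p \/ y = q.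
  move=> /(@seg_cover _ _ dX p q z y)[h|h] gy; first by left; apply: pP; rewrite // segC.
  by right; exact: qP.
have [c [pqc cp cq [h|h]]] := exists_repelled_seg dX cg gp gq fixpq pqz1 pz qz.
  apply: (no_repelling_fixed_point np cF N0 gp cp h) => y pcy gy.
  have [//|E] := fixpq y (seg_trans dX pqc pcy) gy.
  by rewrite E in pcy; case: cq; exact: (seg_anti dX pcy pqc).
apply: (no_repelling_fixed_point np cF N0 gq cq h) => y qcy gy.
have qpc : seg q p c by rewrite segC.
have [E|//] := fixpq y (seg_incl dX (@seg_r _ p q) pqc qcy) gy.
by rewrite E in qcy; case: cp; exact: (seg_anti dX qcy qpc).
Qed.

End UltrafilterContinuity.

Theorem theorem1p8 (R : realType) (X : metricType R) (f : X -> X)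
    (finite_tree_X : is_finite_tree X) (continuous_f : continuous f) :
  [<-> (* a *) is_equicontinuous f;
       (* b *) exists n, (0 < n)%N /\
                 (forall x, image_core f x -> iter n f x = x);
       (* c *) exists n, (0 < n)%N /\ Fix (iter n f) = image_core f;
       (* d *) Per f = image_core f;
       (* e *) ~ (exists A : set X, is_expanding_arc f A);
       (* f *) forall n, (0 < n)%N -> connected (Fix (iter n f));
       (* g *) connected (Per f);
       (* h *) forall u : set_system posnat, is_nonprincipal_ultrafilter u ->
                 continuous (ultra_iter u f);
       (* i *) exists u : set_system posnat, is_nonprincipal_ultrafilter u /\
                 continuous (ultra_iter u f) ].
Proof.
have [[[_ cX _] _ _] _ _] := finite_tree_X.
have gb := Per_connected_periodic_core finite_tree_X continuous_f.
have eg := not_expanding_Per_connected finite_tree_X continuous_f.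
have ba : (exists n, (0 < n)%N /\ (forall x, image_core f x -> iter n f x = x)) ->
    is_equicontinuous f.
  by move=> [n [n0 nid]]; exact: (periodic_core_equicontinuous continuous_f finite_tree_X n0 nid).
have ah u : is_equicontinuous f -> is_nonprincipal_ultrafilter u ->
    continuous (ultra_iter u f).
  by move=> ef [uU _]; exact: equicontinuous_ultra_iter.
(* The implications form a cycle from (a) to (i) and back; a -> b, e -> f, g -> h and i -> a are
   composed by way of (g) or (b). *)
tfae.
- by move=> /(equicontinuous_not_expanding cX)/eg/gb.
- move=> [n [n0 nid]]; exists n; split => //; apply/seteqP; split => [x nx|x /nid//].
  exact: fix_iter_core nx.
- move=> [n [n0 nE]]; apply/seteqP; split; first exact: Per_core.
  by rewrite -nE => x nx; exists n.
- exact: periodic_core_not_expanding.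
- move=> /eg/gb[n [n0 nid]] m m0.
  exact: (periodic_core_Fix_connected finite_tree_X continuous_f n0 nid m0).
- exact: Fix_connected_Per_connected.
- by move=> /gb/ba ef u; exact: ah.
- by move=> h; have [u np] := exists_nonprincipal_ultrafilter; exists u; split => //; exact: h.
- move=> [u [np cu]]; apply/ba/gb.
  exact: (ultra_iter_continuous_Per_connected finite_tree_X continuous_f np cu).
Qed.
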